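(* Let $\mathcal F$ be a pseudo-Finslerian function on $M=\mathbb R^4$ whose metric tensor has signature $(+,-,-,-)$. If on a contractible subset of $T\mathbb R^4$ the electromagnetic tensor is defined as a 2-form $$F=\tfrac12F_{ij}\,dx^i\wedge dx^j+\tilde F_{ia}\,dx^i\wedge\delta y^a$$ on that subset, satisfying $dF=0$, then there exists a horizontal 1-form $$A=A_i(x,y)\,dx^i$$ such that $F=dA$. Moreover, if $\tilde F_{ia}y^i=0$ and $\tilde F_{ia}y^a=0$, then $A_i=\dfrac{\partial L_1}{\partial y^i}$ for some scalar function $L_1(x,y)$ which is 1-homogeneous in $y$.
   Context: All indices run over $1,\dots,4$, with summation over repeated indices. $(x^i,y^i)$ are the coordinates on $T\mathbb R^4$. A pseudo-Finslerian function on $M$ is a function $\mathcal F:TM\to\mathbb R$ that is smooth for $y\ne0$, satisfies $\mathcal F(x,\lambda y)=\lambda\mathcal F(x,y)$ for all $\lambda>0$, and whose metric tensor $g_{ij}(x,y)=\frac12\frac{\partial^2\mathcal F^2}{\partial y^i\partial y^j}$ is nondegenerate for all $x\in M$, $y\in T_xM\setminus\{0\}$; in addition the metric is assumed to have signature $(+,-,-,-)$. The equations of geodesics of $(M,\mathcal F)$ are written $\frac{dy^i}{ds}+2G^i(x,y)=0$, $y^i=\dot x^i$; this defines $G^i$. The Cartan nonlinear connection has coefficients $N^i_{\ j}=\partial G^i/\partial y^j$, and $\delta y^a=dy^a+N^a_{\ i}dx^i$. A 1-form on $TM$ is horizontal if it is of the form $A_i(x,y)dx^i$; $d$ is the exterior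 derivative. 1-homogeneity of $L_1$ in $y$ means $L_1(x,\lambda y)=\lambda L_1(x,y)$, $\lambda\in\mathbb R$, which is taken as equivalent to $\frac{\partial L_1}{\partial y^i}y^i=L_1$.
   Formalization: No such F of signature (+,-,-,-) exists on all y≠0, so F may live on an open positively conic set of nonzero vectors; if that is not all y≠0, nonempty fibres of the open contractible set are assumed contractible. L_1 scales along segments staying in the set. *)

(* Defs.v *)
From HB Require Import structures.
From mathcomp Require Import all_boot all_order all_algebra.
From mathcomp Require Import all_classical all_reals all_analysis.

Set Implicit Arguments.
Unset Strict Implicit.
Unset Printing Implicit Defensive.

Import Order.TTheory GRing.Theory Num.Theory.
Import numFieldNormedType.Exports.

Local Open Scope classical_set_scope.
Local Open Scope ring_scope.

(* R^4, and its tangent bundle with the global coordinates z = (x, y). *)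
Notation base R := 'rV[R]_4.
Notation tangent R := ('rV[R]_4 * 'rV[R]_4)%type.

Definition contractible (R : realType) (T : topologicalType) (U : set T) : Prop :=
  exists (c : T) (H : R * T -> T),
    [/\ U c,
        {within `[0, 1] `*` U, continuous H},
        forall t z, t \in `[0, 1] -> U z -> U (H (t, z)) &
        forall z, U z -> H (0, z) = z /\ H (1, z) = c].

Section Calculus.
Context {R : realType}.

Definition slit : set (tangent R) := [set z | z.2 != 0].

Definition fiber (U : set (tangent R)) (x : base R) : set (base R) :=
  [set y | U (x, y)].

(* On an open set, C^k is existence and continuity of all iterated directional
   derivatives up to order k. *)
Fixpoint Ck_on (V : normedModType R) (k : nat) (U : set V) (f : V -> R) : Prop :=
  (forall z, U z -> {for z, continuous f}) /\
  (if k is k'.+1 then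
     forall v : V, (forall z, U z -> derivable f z v) /\
                   Ck_on k' U (fun z => 'D_v f z)
   else True).

Definition smooth_on (V : normedModType R) (U : set V) (f : V -> R) : Prop :=
  forall k, Ck_on k U f.

Definition e_ (i : 'I_4) : base R := delta_mx ord0 i.

(* Partial derivatives with respect to x^i and y^i. *)
Definition dX (i : 'I_4) (f : tangent R -> R) (z : tangent R) : R :=
  'D_((e_ i, 0) : tangent R) f z.
Definition dY (i : 'I_4) (f : tangent R -> R) (z : tangent R) : R :=
  'D_((0, e_ i) : tangent R) f z.

End Calculus.

Section Finsler.
Context {R : realType}.
Implicit Types (F : tangent R -> R) (z : tangent R).

Definition Fsq F z : R := F z ^+ 2.

Definition metric F z : 'M[R]_4 :=
  \matrix_(i, j) (2^-1 * dY i (dY j (Fsq F)) z).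

(* diag(+1, -1, -1, -1) *)
Definition eta : 'M[R]_4 :=
  diag_mx (\row_(i < 4) (if i == ord0 then 1 else -1)).

Definition lorentzian (g : 'M[R]_4) : Prop :=
  exists P : 'M[R]_4, P \in unitmx /\ P *m g *m P^T = eta.

(* A pseudo-Finslerian function of signature (+,-,-,-) with domain D, an open
   set of nonzero vectors stable under positive scaling. The case of a function
   defined on all nonzero vectors is D = slit. *)
Definition pseudo_finsler (D : set (tangent R)) F : Prop :=
  [/\ open D /\ D `<=` slit,
      forall x y (l : R), 0 < l -> D (x, y) -> D (x, l *: y),
      smooth_on D F,
      forall x y (l : R), 0 < l -> D (x, y) -> F (x, l *: y) = l * F (x, y) &
      forall z, D z -> metric F z \in unitmx /\ lorentzian (metric F z)].

(* The covector
     (d^2 F^2/dx^k dy^l) y^k - dF^2/dx^l,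
   i.e. the part of d/ds (dF^2/dy^l) - dF^2/dx^l free of dy^j/ds. *)
Definition el_rest F z : 'rV[R]_4 :=
  \row_l (\sum_(k < 4) dX k (dY l (Fsq F)) z * z.2 ord0 k - dX l (Fsq F) z).

(* d/ds (dF^2/dy^l) - dF^2/dx^l along a curve with dx/ds = y and dy/ds = a. *)
Definition euler_lagrange F z (a : 'rV[R]_4) (l : 'I_4) : R :=
  \sum_(j < 4) dY j (dY l (Fsq F)) z * a ord0 j + el_rest F z ord0 l.

(* G^i = (1/4) g^{il} ((d^2 F^2/dx^k dy^l) y^k - dF^2/dx^l); see geodesicE. *)
Definition spray F (i : 'I_4) z : R :=
  4^-1 * (el_rest F z *m invmx (metric F z)) ord0 i.

(* The geodesic equations are dy^i/ds + 2 G^i = 0. *)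
Lemma geodesicE F z (a : 'rV[R]_4) : metric F z \in unitmx ->
  (forall l, euler_lagrange F z a l = 0) <->
  (forall i, a ord0 i + 2 * spray F i z = 0).
Proof.
move=> gU; set g := metric F z in gU *; set b := el_rest F z.
have EL l : euler_lagrange F z a l = (2 *: (a *m g) + b) ord0 l.
  rewrite /euler_lagrange !mxE mulr_sumr; congr (_ + _).
  by apply: eq_bigr => j _; rewrite /g mxE [in RHS]mulrCA mulVKf ?pnatr_eq0 // mulrC.
have SP i : a ord0 i + 2 * spray F i z = (a + 2^-1 *: (b *m invmx g)) ord0 i.
  rewrite [in RHS]mxE [in X in _ = _ + X]mxE /spray -/b -/g mulrA.
  congr (_ + _ * _).
  by rewrite (_ : 4 = 2 * 2 :> R) ?invfM ?mulVKf // -natrM.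
have key : (2 *: (a + 2^-1 *: (b *m invmx g))) *m g = 2 *: (a *m g) + b.
  by rewrite scalerDr scalerA divff // scale1r mulmxDl -scalemxAl mulmxKV.
split=> h.
- have /eqP h0 : (2 *: (a + 2^-1 *: (b *m invmx g))) *m g = 0.
    by rewrite key; apply/rowP => l; rewrite -EL h mxE.
  move: h0; rewrite -(mul0mx _ g) => /eqP /(can_inj (mulmxK gU)) /eqP.
  rewrite scaler_eq0 pnatr_eq0 /= => /eqP h0 i.
  by rewrite SP h0 mxE.
- have h0 : a + 2^-1 *: (b *m invmx g) = 0.
    by apply/rowP => i; rewrite -SP h mxE.
  by move=> l; rewrite EL -key h0 scaler0 mul0mx mxE.
Qed.

(* N^i_j *)
Definition cartan F (i j : 'I_4) z : R := dY j (spray F i) z.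

End Finsler.

Section Forms.
Context {R : realType}.

(* A k-form on the tangent bundle: a function of the point and of k tangent
   vectors v = (v.1, v.2), with dx^i(v) = v.1_i and dy^a(v) = v.2_a. *)
Definition kform (k : nat) := tangent R -> ('I_k -> tangent R) -> R.

Definition smooth_form k (U : set (tangent R)) (w : kform k) : Prop :=
  forall v, smooth_on U (fun z => w z v).

(* Exterior derivative; the arguments v are constant vector fields, so there are
   no bracket terms. *)
Definition ext_d k (w : kform k) : kform k.+1 := fun z v =>
  \sum_(i < k.+1) (-1) ^+ i * 'D_(v i) (fun z' => w z' (fun j => v (lift i j))) z.

Definition wedge (a b : kform 1) : kform 2 := fun z v =>
  a z (fun=> v ord0) * b z (fun=> v ord_max) -
  a z (fun=> v ord_max) * b z (fun=> v ord0).

Definition dx_ (i : 'I_4) : kform 1 := fun _ v => (v ord0).1 ord0 i.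
Definition dy_ (a : 'I_4) : kform 1 := fun _ v => (v ord0).2 ord0 a.

Definition deltay (F : tangent R -> R) (a : 'I_4) : kform 1 := fun z v =>
  dy_ a z v + \sum_(i < 4) cartan F a i z * dx_ i z v.

Definition em_form (F : tangent R -> R) (Fh Fm : 'I_4 -> 'I_4 -> tangent R -> R)
    : kform 2 := fun z v =>
  2^-1 * \sum_(i < 4) \sum_(j < 4) Fh i j z * wedge (dx_ i) (dx_ j) z v +
  \sum_(i < 4) \sum_(a < 4) Fm i a z * wedge (dx_ i) (deltay F a) z v.

Definition horizontal_form (A : 'I_4 -> tangent R -> R) : kform 1 := fun z v =>
  \sum_(i < 4) A i z * dx_ i z v.

(* Euler's identity, together with the scaling law wherever it makes sense on a
   domain U that need not be conic: the vectors y and l *: y have to be joined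
   inside U by multiples of y. *)
Definition homogeneous1_on (U : set (tangent R)) (L : tangent R -> R) : Prop :=
  (forall z, U z -> \sum_(i < 4) dY i L z * z.2 ord0 i = L z) /\
  (forall x y (l : R),
     (forall t : R, t \in `[0, 1] -> U (x, (1 - t + t * l) *: y)) ->
     L (x, l *: y) = l * L (x, y)).

End Forms.

(* Main.v *)
(** Let [w] be a closed 2-form on [U] with no [dy /\ dy] component.  A topological
    contraction of an open set can be replaced by a smooth one, by glueing local
    choices (the identity near time 0, the constant near time 1, constant
    approximations in between) with a partition of unity.  Integrating the pullback
    of [w] along it gives a 1-form [B] with [dB = w].  The [dy]-part of [B] is closed
    on every fibre [U_x]; the fibres being contractible it has there a primitive
    [phi_x], unique up to a constant, and a partition of unity on the base makes the
    choice of the constants smooth in [x].  Then [A = B - d phi] is horizontal.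

    The fibres are known to be contractible only when the Finsler function is not
    defined on all nonzero vectors; but the signature excludes that case: at a minimum
    of its square on a Euclidean sphere of the fibre the metric would be positive
    semidefinite.

    For the second claim take [L1 = A_i y^i], since [dA_i/dy^a = - Fm i a]. *)

From HB Require Import structures.
Require Import Defs.
From mathcomp Require Import all_boot all_order all_algebra.
From mathcomp Require Import all_classical all_reals all_analysis.
From mathcomp Require Import ring lra.
Import Order.TTheory GRing.Theory Num.Theory.
Import numFieldNormedType.Exports.
Local Open Scope classical_set_scope.
Local Open Scope ring_scope.
Set Implicit Arguments.
Unset Strict Implicit.
Unset Printing Implicit Defensive.

(** * Functions of class C^k *)

(** [smooth_on] speaks only of directional derivatives, whereas pulling a form back needs the chain
    rule. Hence the abstract [coords]: in finite dimension, continuous directional derivatives yield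
    a differential, and one set of lemmas serves the line, the fibres, the tangent bundle and their
    products with time. Integrals over [0, 1] are differences of antiderivatives, so estimates under
    the integral sign reduce to the mean value theorem and compactness of the segment. The main
    obstacle is the dependence of [phi_x] on [x]: the contractions of different fibres are given
    separately, with no relation between neighbours. Two facts overcome it. A difference of two
    values of [phi_x] in one fibre does not depend on the additive constant, and it can be computed
    along any path in that fibre; the contraction of one fibre, followed inside nearby fibres,
    supplies paths that vary smoothly. The constants are therefore normalised so that only such
    differences occur. *)

Section DirectionalDerivatives.
Context {R : realType} {V : normedModType R}.
Implicit Types (f g : V -> R) (a v z : V) (U W : set V).

Lemma is_derive_line f a v (t : R) : derivable f (a + t *: v) v ->
  is_derive t (1 : R) (fun s : R => f (a + s *: v)) ('D_v f (a + t *: v)).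
Proof.
move=> df.
have E : (fun h : R => h^-1 *: (((fun s : R => f (a + s *: v)) \o shift t) (h *: (1 : R))
     - f (a + t *: v))) =
  (fun h : R => h^-1 *: ((f \o shift (a + t *: v)) (h *: v) - f (a + t *: v))).
  apply/funext => h /=; congr (_ *: (f _ - _)).
  by rewrite [h *: 1]mulr1 scalerDl addrCA.
by apply: DeriveDef; rewrite /derivable /derive E.
Qed.

(** Only the derivative along [v] is assumed, so no differential is available: the line through [a]
    is reparametrised by [s * c], which also covers [c = 0]. *)
Lemma derive_scale f a v (c : R) : derivable f a v ->
  derivable f a (c *: v) /\ 'D_(c *: v) f a = c * 'D_v f a.
Proof.
move=> df.
have /is_derive_line : derivable f (a + 0 *: v) v by rewrite scale0r addr0.
rewrite scale0r addr0 => dl.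
have dc : is_derive (0 : R) (1 : R) (fun s : R => s * c) c.
  have -> : (fun s : R => s * c) = c \*: id :> (R -> R).
    by apply/funext => s; rewrite /= mulrC.
  by apply: is_derive_eq; rewrite [_ *: _]mulr1.
have dl' : is_derive (0 * c) (1 : R) (fun s : R => f (a + s *: v)) ('D_v f a).
  by rewrite mul0r.
have := @is_derive1_comp R (fun s : R => f (a + s *: v)) (fun s => s * c) 0 _ _ dl' dc.
have -> : (fun s : R => f (a + s *: v)) \o (fun s => s * c) =
   (fun h : R => f (h *: (c *: v) + a)).
  by apply/funext => h /=; rewrite scalerA addrC.
move=> [dh eh]; split; first by apply: (derivable1P f a (c *: v)).2; exact: dh.
rewrite mulrC -eh /derive.
set g1 := fun h => h^-1 *: _; set g2 := fun h => h^-1 *: _.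
suff -> : g1 = g2 by [].
apply/funext => h; rewrite /g1 /g2 /=.
by rewrite scale0r add0r addr0 [h *: 1]mulr1.
Qed.

Lemma mvt_line f a v :
  (forall t : R, 0 <= t <= 1 -> derivable f (a + t *: v) v) ->
  exists2 t : R, 0 <= t <= 1 & f (a + v) - f a = 'D_v f (a + t *: v).
Proof.
move=> df.
have dl (t : R) : t \in `]0, 1[ -> is_derive t (1 : R) (fun s : R => f (a + s *: v))
    ('D_v f (a + t *: v)).
  by rewrite in_itv /= => /andP[t0 t1]; apply/is_derive_line/df; rewrite !ltW.
have := @MVT_segment R (fun s : R => f (a + s *: v)) (fun t => 'D_v f (a + t *: v)) 0 1 ler01 dl.
case.
  apply: derivable_within_continuous => t; rewrite in_itv /= => /df /is_derive_line.
  by case.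
move=> t; rewrite in_itv /= scale1r scale0r addr0 subr0 mulr1 => t01 E.
by exists t.
Qed.

Lemma eq_near_in U f g z : open U -> U z -> (forall x, U x -> f x = g x) ->
  \near z, f z = g z.
Proof.
by move=> oU Uz E; near=> x; apply: E; near: x; exact: open_nbhs_nbhs.
Unshelve. all: by end_near. Qed.

Lemma derive_eq_in U f g z v : open U -> U z -> (forall x, U x -> f x = g x) ->
  derivable f z v -> derivable g z v /\ 'D_v g z = 'D_v f z.
Proof.
move=> oU Uz E df; have nE := eq_near_in oU Uz E.
split; first exact: near_eq_derivable df.
by apply/esym; exact: near_eq_derive.
Qed.

End DirectionalDerivatives.

Section Ck.
Context {R : realType} {V : normedModType R}.
Implicit Types (f g : V -> R) (v z : V) (U W : set V).

Lemma Ck_cont k U f z : Ck_on k U f -> U z -> {for z, continuous f}.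
Proof. by case: k => [|k] /= [h _]; exact: h. Qed.

Lemma Ck_derivable k U f z v : Ck_on k.+1 U f -> U z -> derivable f z v.
Proof. by move=> [_ /(_ v)[h _]]; exact: h. Qed.

Lemma Ck_derive k U f v : Ck_on k.+1 U f -> Ck_on k U (fun z => 'D_v f z).
Proof. by move=> [_ /(_ v)[]]. Qed.

Lemma Ck_weak k U f : Ck_on k.+1 U f -> Ck_on k U f.
Proof.
elim: k f => [|k IH] f [cf df]; split=> //= v.
by have [d1 d2] := df v; split=> //; exact: IH.
Qed.

Lemma Ck_sub k U W f : W `<=` U -> Ck_on k U f -> Ck_on k W f.
Proof.
move=> WU; elim: k f => [|k IH] f [cf df]; split=> //=.
- by move=> z /WU /cf.
- by move=> z /WU /cf.
- by move=> v; have [d1 d2] := df v; split=> [z /WU /d1|] //; exact: IH.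
Qed.

Lemma Ck_ext k U f g : open U -> (forall z, U z -> f z = g z) ->
  Ck_on k U f -> Ck_on k U g.
Proof.
move=> oU; elim: k f g => [|k IH] f g E [cf df].
  split=> // z Uz; rewrite /prop_for /continuous_at -(E z Uz).
  by apply: cvg_trans (cf z Uz); apply: near_eq_cvg; exact: eq_near_in Uz E.
split=> [z Uz|v].
  rewrite /prop_for /continuous_at -(E z Uz).
  by apply: cvg_trans (cf z Uz); apply: near_eq_cvg; exact: eq_near_in Uz E.
have [d1 d2] := df v; split=> [z Uz|].
  by have [] := derive_eq_in oU Uz E (d1 z Uz).
apply: IH d2 => z Uz.
by have [_ ->] := derive_eq_in oU Uz E (d1 z Uz).
Qed.

(** [Ck_on] is a pointwise condition, with continuity and derivatives taken in the ambient space, so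
    it can be checked on any family of sets covering [U]. *)
Lemma Ck_local k U f :
  (forall z, U z -> exists W, W z /\ Ck_on k W f) -> Ck_on k U f.
Proof.
elim: k f => [|k IH] f H; split=> //=.
- by move=> z /H[W [Wz /Ck_cont]]; exact.
- by move=> z /H[W [Wz /Ck_cont]]; exact.
move=> v; split=> [z /H[W [Wz /Ck_derivable]]|]; first exact.
by apply: IH => z /H[W [Wz /Ck_derive HW]]; exists W.
Qed.

Lemma Ck_cst k U (c : R) : Ck_on k U (fun=> c).
Proof.
elim: k c => [|k IH] c; split=> //=; try by move=> z _; exact: cst_continuous.
move=> v; split=> [z _|]; first exact: derivable_cst.
have -> : (fun z => 'D_v (fun=> c) z) = (fun=> 0) :> (V -> R).
  by apply/funext => z; exact: derive_cst.
exact: IH.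
Qed.

Lemma Ck_add k U f g : open U -> Ck_on k U f -> Ck_on k U g ->
  Ck_on k U (fun z => f z + g z).
Proof.
move=> oU; elim: k f g => [|k IH] f g Hf Hg.
  split=> // z Uz; apply: continuousD; [exact: Ck_cont Hf Uz|exact: Ck_cont Hg Uz].
split=> [z Uz|v].
  by apply: continuousD; [exact: Ck_cont Hf Uz|exact: Ck_cont Hg Uz].
split=> [z Uz|].
  by apply: derivableD; [exact: Ck_derivable Hf Uz|exact: Ck_derivable Hg Uz].
apply: (@Ck_ext _ _ (fun z => 'D_v f z + 'D_v g z)) => // [z Uz|].
  by rewrite [RHS]deriveD //; [exact: Ck_derivable Hf Uz|exact: Ck_derivable Hg Uz].
by apply: IH; exact: Ck_derive.
Qed.

Lemma Ck_mul k U f g : open U -> Ck_on k U f -> Ck_on k U g ->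
  Ck_on k U (fun z => f z * g z).
Proof.
move=> oU; elim: k f g => [|k IH] f g Hf Hg.
  split=> // z Uz; apply: continuousM; [exact: Ck_cont Hf Uz|exact: Ck_cont Hg Uz].
split=> [z Uz|v].
  by apply: continuousM; [exact: Ck_cont Hf Uz|exact: Ck_cont Hg Uz].
split=> [z Uz|].
  by apply: derivableM; [exact: Ck_derivable Hf Uz|exact: Ck_derivable Hg Uz].
apply: (@Ck_ext _ _ (fun z => f z * 'D_v g z + g z * 'D_v f z)) => // [z Uz|].
  by rewrite [RHS]deriveM //; [exact: Ck_derivable Hf Uz|exact: Ck_derivable Hg Uz].
by apply: Ck_add => //; apply: IH; try exact: Ck_weak; exact: Ck_derive.
Qed.

Lemma Ck_opp k U f : open U -> Ck_on k U f -> Ck_on k U (fun z => - f z).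
Proof.
move=> oU Hf; apply: (@Ck_ext _ _ (fun z => -1 * f z)) => // [z _|].
  by rewrite mulN1r.
by apply: Ck_mul => //; exact: Ck_cst.
Qed.

Lemma Ck_sum k U (I : Type) (r : seq I) (P : pred I) (f : I -> V -> R) : open U ->
  (forall i, P i -> Ck_on k U (f i)) -> Ck_on k U (fun z => \sum_(i <- r | P i) f i z).
Proof.
move=> oU H; elim: r => [|i r IH].
  apply: (@Ck_ext _ _ (fun=> 0)) => // [z _|]; first by rewrite big_nil.
  exact: Ck_cst.
case Pi : (P i).
  apply: (@Ck_ext _ _ (fun z => f i z + \sum_(i <- r | P i) f i z)) => // [z _|].
    by rewrite big_cons Pi.
  by apply: Ck_add => //; exact: H.
by apply: Ck_ext IH => // z _; rewrite big_cons Pi.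
Qed.

Lemma Ck_inv k U f : open U -> (forall z, U z -> f z != 0) -> Ck_on k U f ->
  Ck_on k U (fun z => (f z)^-1).
Proof.
move=> oU f0; elim: k => [|k IH] Hf.
  by split=> // z Uz; apply: continuousV; [exact: f0|exact: Ck_cont Hf Uz].
split=> [z Uz|v].
  by apply: continuousV; [exact: f0|exact: Ck_cont Hf Uz].
split=> [z Uz|].
  by apply: derivableV; [exact: f0|exact: Ck_derivable Hf Uz].
apply: (@Ck_ext _ _ (fun z => - ((f z)^-1 * (f z)^-1) * 'D_v f z)) => // [z Uz|].
  rewrite [RHS]deriveV; [|exact: f0|exact: Ck_derivable Hf Uz].
  by rewrite -invfM -expr2.
have Hi := IH (Ck_weak Hf).
apply: Ck_mul => //; last exact: Ck_derive.
by apply: Ck_opp => //; exact: Ck_mul.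
Qed.

Lemma smooth_sub U W f : W `<=` U -> smooth_on U f -> smooth_on W f.
Proof. by move=> WU H k; exact: Ck_sub (H k). Qed.

Lemma smooth_ext U f g : open U -> (forall z, U z -> f z = g z) ->
  smooth_on U f -> smooth_on U g.
Proof. by move=> oU E H k; exact: Ck_ext (H k). Qed.

Lemma smooth_local U f :
  (forall z, U z -> exists W, W z /\ smooth_on W f) -> smooth_on U f.
Proof. by move=> H k; apply: Ck_local => z /H[W [Wz HW]]; exists W. Qed.

Lemma smooth_cst U (c : R) : smooth_on U (fun=> c).
Proof. by move=> k; exact: Ck_cst. Qed.

Lemma smooth_add U f g : open U -> smooth_on U f -> smooth_on U g ->
  smooth_on U (fun z => f z + g z).
Proof. by move=> oU Hf Hg k; exact: Ck_add. Qed.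

Lemma smooth_mul U f g : open U -> smooth_on U f -> smooth_on U g ->
  smooth_on U (fun z => f z * g z).
Proof. by move=> oU Hf Hg k; exact: Ck_mul. Qed.

Lemma smooth_opp U f : open U -> smooth_on U f -> smooth_on U (fun z => - f z).
Proof. by move=> oU Hf k; exact: Ck_opp. Qed.

Lemma smooth_sum U (I : Type) (r : seq I) (P : pred I) (f : I -> V -> R) : open U ->
  (forall i, P i -> smooth_on U (f i)) ->
  smooth_on U (fun z => \sum_(i <- r | P i) f i z).
Proof. by move=> oU H k; apply: Ck_sum => // i Pi; exact: H. Qed.

Lemma smooth_inv U f : open U -> (forall z, U z -> f z != 0) -> smooth_on U f ->
  smooth_on U (fun z => (f z)^-1).
Proof. by move=> oU f0 Hf k; exact: Ck_inv. Qed.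

Lemma smooth_derive U f v : smooth_on U f -> smooth_on U (fun z => 'D_v f z).
Proof. by move=> H k; exact: Ck_derive (H k.+1). Qed.

Lemma smooth_cont U f z : smooth_on U f -> U z -> {for z, continuous f}.
Proof. by move=> /(_ 0%N); exact: Ck_cont. Qed.

Lemma smooth_derivable U f z v : smooth_on U f -> U z -> derivable f z v.
Proof. by move=> /(_ 1%N); exact: Ck_derivable. Qed.

End Ck.

(** * Coordinates and the chain rule *)

(** A finite-dimensional normed space, presented by continuous coordinates and vectors that
    reconstruct each point. The abstraction lets [R], rows, and products such as time times a fibre
    share one chain rule. *)
Record coords (R : realType) (E : normedModType R) := Coords {
  cdim : finType;
  cvec : cdim -> E;
  ccrd : cdim -> {linear E -> R};
  ccrd_cont : forall i, continuous (ccrd i);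
  ccrdE : forall v, v = \sum_i ccrd i v *: cvec i }.

Lemma cvg_bigsum {R : realType} {W : normedModType R} (T : Type) (F : set_system T)
    (FF : Filter F) (I : Type) (r : seq I) (f : I -> T -> W) (a : I -> W) :
  (forall i, f i x @[x --> F] --> a i) ->
  (\sum_(i <- r) f i x) @[x --> F] --> \sum_(i <- r) a i.
Proof.
move=> H; elim: r => [|i r IH].
  rewrite big_nil (_ : (fun x => \sum_(i <- [::]) f i x) = cst 0); first exact: cvg_cst.
  by apply/funext => x; rewrite big_nil.
rewrite big_cons (_ : (fun x => \sum_(j <- i :: r) f j x) =
  (fun x => f i x + \sum_(j <- r) f j x)); first exact: cvgD.
by apply/funext => x; rewrite big_cons.
Qed.

Section LineComposition.
Context {R : realType} {V W : normedModType R}.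

Lemma derive_lineE (f : V -> W) (x v : V) :
  'D_v f x = 'D_(1 : R) (fun h : R => f (h *: v + x)) (0 : R).
Proof.
rewrite /derive; set g1 := fun h => h^-1 *: _; set g2 := fun h => h^-1 *: _.
suff -> : g1 = g2 by [].
by apply/funext => h; rewrite /g1 /g2 /= addr0 scale0r add0r [_%:A]mulr1.
Qed.

Lemma is_derive1_scalel (k : R -> R) (w : W) (x dk : R) :
  is_derive x (1 : R) k dk -> is_derive x (1 : R) (fun s => k s *: w) (dk *: w).
Proof.
move=> [dk1 <-]; have dkx : differentiable k x by exact/derivable1_diffP.
have dkw : differentiable (fun s => k s *: w) x by exact: differentiableZl.
apply: DeriveDef; first exact/derivable1_diffP.
by rewrite !deriveE // diffZl.
Qed.

Lemma is_derive_bigsum (I : Type) (r : seq I) (f : I -> V -> W) (df : I -> W) (x v : V) :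
  (forall i, is_derive x v (f i) (df i)) ->
  is_derive x v (fun z => \sum_(i <- r) f i z) (\sum_(i <- r) df i).
Proof.
move=> H; elim: r => [|i r IH].
  have -> : (fun z => \sum_(i <- [::]) f i z) = cst 0.
    by apply/funext => z; rewrite big_nil.
  rewrite big_nil; exact: is_derive_cst.
have -> : (fun z => \sum_(j <- i :: r) f j z) = f i + (fun z => \sum_(j <- r) f j z).
  by apply/funext => z; rewrite big_cons.
by rewrite big_cons; exact: is_deriveD.
Qed.

End LineComposition.

Section Coordinates.
Context {R : realType} {E : normedModType R} (cs : coords E).
Implicit Types (f : E -> R) (U : set E).

Lemma ccrd_bound (i : cdim cs) : exists2 k : R, 0 < k & forall v, `|ccrd i v| <= k * `|v|.
Proof. exact: linear_lipschitz (@ccrd_cont _ _ cs i). Qed.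

Lemma is_derive_ccrd (i : cdim cs) (z v : E) : is_derive z v (ccrd i) (ccrd i v).
Proof.
have dl : differentiable (ccrd i) z by exact/linear_differentiable/ccrd_cont.
apply: DeriveDef; first exact: diff_derivable.
by rewrite deriveE // diff_lin //; exact: ccrd_cont.
Qed.

Lemma smooth_ccrd U (i : cdim cs) : smooth_on U (ccrd i).
Proof.
case=> [|k]; split=> //=; try by move=> z _; exact: ccrd_cont.
move=> v; split=> [z _|]; first by have [] := is_derive_ccrd i z v.
have -> : (fun z => 'D_v (ccrd i) z) = (fun=> ccrd i v).
  by apply/funext => z; have [_ ->] := is_derive_ccrd i z v.
exact: Ck_cst.
Qed.

(* The mean value theorem applied to one coordinate at a time. *)
Lemma C1_estimate U f z (e : R) : open U -> Ck_on 1 U f -> U z -> 0 < e ->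
  exists2 d : R, 0 < d & forall (h : E) (s : seq (cdim cs)),
    \sum_(i <- s) `|ccrd i h| * `|cvec i| < d ->
    `|f (z + \sum_(i <- s) ccrd i h *: cvec i) - f z -
      \sum_(i <- s) ccrd i h * 'D_(cvec i) f z| <= e * \sum_(i <- s) `|ccrd i h|.
Proof.
move=> oU Hf Uz e0.
have : \forall w \near z, U w /\ forall i : cdim cs,
    `|'D_(cvec i) f z - 'D_(cvec i) f w| < e.
  near=> w; split; first by near: w; exact: open_nbhs_nbhs.
  near: w; apply: filter_forall => i.
  have /cvgrPdist_lt/(_ e e0) := Ck_cont (Ck_derive (cvec i) Hf) Uz.
  by apply: filterS.
move=> /nbhs_normP[d d0 Hd]; exists d => // h.
elim=> [|i s IH]; first by rewrite !big_nil addr0 subrr subrr normr0 mulr0.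
rewrite !big_cons => Hs.
set T := \sum_(j <- s) ccrd j h *: cvec j in IH *.
have Ts : `|T| <= \sum_(j <- s) `|ccrd j h| * `|cvec j|.
  apply: le_trans (ler_norm_sum _ _ _) _.
  by apply: ler_sum => j _; rewrite normrZ.
have near_z (t : R) : 0 <= t <= 1 -> (ball_ Num.norm z d) (z + T + t *: (ccrd i h *: cvec i)).
  move=> /andP[t0 t1] /=; rewrite -addrA opprD addrA subrr sub0r normrN.
  apply: le_lt_trans Hs; apply: le_trans (ler_normD _ _) _.
  rewrite addrC; apply: lerD => //; rewrite !normrZ (ger0_norm t0).
  by rewrite ler_piMl // mulr_ge0.
have [t t01] : exists2 t : R, 0 <= t <= 1 &
    f (z + T + ccrd i h *: cvec i) - f (z + T) =
    'D_(ccrd i h *: cvec i) f (z + T + t *: (ccrd i h *: cvec i)).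
  apply: mvt_line => t t01; have [Uw _] := Hd _ (near_z t t01).
  by have [] := derive_scale (ccrd i h) (Ck_derivable (v := cvec i) Hf Uw).
have [Uw /(_ i) Dw] := Hd _ (near_z t t01).
have [_ ->] := derive_scale (ccrd i h) (Ck_derivable (v := cvec i) Hf Uw) => Emv.
have {}IH : `|f (z + T) - f z - \sum_(j <- s) ccrd j h * 'D_(cvec j) f z| <=
    e * \sum_(j <- s) `|ccrd j h|.
  by apply: IH; apply: le_lt_trans Hs; rewrite lerDr mulr_ge0.
rewrite (addrC _ T) addrA.
set w := z + T + t *: _ in Emv Dw.
have -> : f (z + T + ccrd i h *: cvec i) - f z - (ccrd i h * 'D_(cvec i) f z +
     \sum_(j <- s) ccrd j h * 'D_(cvec j) f z) =
  (f (z + T) - f z - \sum_(j <- s) ccrd j h * 'D_(cvec j) f z) +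
  ccrd i h * ('D_(cvec i) f w - 'D_(cvec i) f z).
  have -> : f (z + T + ccrd i h *: cvec i) = f (z + T) + ccrd i h * 'D_(cvec i) f w.
    by rewrite -Emv addrCA subrr addr0.
  by ring.
apply: le_trans (ler_normD _ _) _; rewrite [leRHS]mulrDr [leRHS]addrC; apply: lerD => //.
by rewrite normrM mulrC ler_wpM2r // distrC ltW.
Unshelve. all: by end_near. Qed.

(** The candidate differential is built from the derivatives along the [cvec i]; [C1_estimate]
    bounds its error by a small multiple of the coordinates, hence of the norm. *)
Lemma C1_differentiable U f z : open U -> Ck_on 1 U f -> U z -> differentiable f z.
Proof.
move=> oU Hf Uz.
pose L (v : E) : R := \sum_i ccrd (c := cs) i v * 'D_(cvec i) f z.
have Ll : linear L.
  move=> a u v; rewrite /L scaler_sumr -big_split /=; apply: eq_bigr => i _.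
  by rewrite linearP mulrDl -scalerAl.
pose lM := GRing.isLinear.Build _ _ _ _ _ Ll.
pose Lin : {linear E -> R} := HB.pack L lM.
have Lc : continuous Lin.
  move=> v; rewrite /Lin /= /L.
  apply: cvg_bigsum => i.
  by apply: cvgM; [exact: ccrd_cont|exact: cvg_cst].
have Lo : f \o shift z = cst (f z) + Lin +o_ 0 id.
  apply/eqaddoP => e e0.
  have [k k0 Hk] : exists2 k : R, 0 < k & forall v, \sum_(i : cdim cs) `|ccrd i v| <= k * `|v|.
    have [g Hg] := choice (fun i : cdim cs => let: ex_intro2 k a b := ccrd_bound i in
      ex_intro (fun k => 0 < k /\ forall v, `|ccrd i v| <= k * `|v|) k (conj a b)).
    exists (1 + \sum_i g i) => [|v].
      by rewrite ltr_wpDr // sumr_ge0 // => i _; have [/ltW] := Hg i.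
    rewrite mulrDl mul1r mulr_suml ler_wpDl //.
    by apply: ler_sum => i _; have [_] := Hg i.
  have [k2 k20 Hk2] : exists2 k : R, 0 < k & forall v,
      \sum_(i : cdim cs) `|ccrd i v| * `|cvec i| <= k * `|v|.
    exists (k * (1 + \sum_(i : cdim cs) `|cvec i|)) => [|v].
      by rewrite mulr_gt0 // ltr_wpDr // sumr_ge0.
    rewrite mulrAC; apply: le_trans (_ : (\sum_i `|ccrd i v|) * (1 + \sum_(i : cdim cs) `|cvec i|) <= _).
      rewrite mulr_suml; apply: ler_sum => i _; rewrite ler_wpM2l //.
      by rewrite ler_wpDl // (bigD1 i) //= lerDl sumr_ge0.
    by rewrite ler_wpM2r // addr_ge0 // sumr_ge0.
  (* [k] bounds the sum of the coordinates by the norm, so the tolerance [e / k] yields an error of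
     at most [e] times the norm of [h]; [k2] keeps the weighted sum below [d] for small [h]. *)
  have [d d0 Hd] := C1_estimate oU Hf Uz (divr_gt0 e0 k0).
  near=> h.
  have hE : h = \sum_(i : cdim cs) ccrd i h *: cvec i by exact: ccrdE.
  have -> : (f \o shift z - (cst (f z) + (Lin : E -> R))) h =
      f (z + \sum_(i : cdim cs) ccrd i h *: cvec i) - f z - L h.
    by rewrite -hE [z + h]addrC -addrA -opprD.
  apply: le_trans (Hd h (index_enum (cdim cs)) _) _.
    apply: le_lt_trans (Hk2 h) _; rewrite mulrC -ltr_pdivlMr //.
    near: h; apply: nbhs0_lt; exact: divr_gt0.
  by rewrite -mulrA ler_wpM2l ?(ltW e0) // mulrC ler_pdivrMr // mulrC.
apply/diff_locallyP; rewrite (diff_unique Lc Lo); split=> //.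
Unshelve. all: by end_near. Qed.

Lemma C1_deriveE U f z v : open U -> Ck_on 1 U f -> U z ->
  'D_v f z = \sum_i ccrd i v * 'D_(cvec (c := cs) i) f z.
Proof.
move=> oU Hf Uz; have df := C1_differentiable oU Hf Uz.
rewrite deriveE // {1}[v](ccrdE cs) linear_sum; apply: eq_bigr => i _.
by rewrite linearZ deriveE.
Qed.

Lemma C1_deriveD U f z (a : R) u v : open U -> Ck_on 1 U f -> U z ->
  'D_(a *: u + v) f z = a * 'D_u f z + 'D_v f z.
Proof.
move=> oU Hf Uz; have df := C1_differentiable oU Hf Uz.
by rewrite !deriveE // linearP.
Qed.

End Coordinates.

Section ChainRule.
Context {R : realType} {V E : normedModType R} (cs : coords E).
Implicit Types (f : E -> R) (K : V -> E) (U : set V).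

(** [K] is only known to have derivatives along [v], so the rule is proved on the curve
    [s => K (s *: v + z)], which is differentiable as a function of one variable. *)
Lemma is_derive_comp f K z v : differentiable f (K z) ->
  (forall i, derivable (ccrd (c := cs) i \o K) z v) ->
  is_derive z v (f \o K)
    (\sum_i 'D_v (ccrd i \o K) z * 'D_(cvec (c := cs) i) f (K z)).
Proof.
move=> df dK.
pose l (s : R) : E := K (s *: v + z).
have l0 : l 0 = K z by rewrite /l scale0r add0r.
have dl : is_derive (0 : R) (1 : R) l (\sum_i 'D_v (ccrd i \o K) z *: cvec (c := cs) i).
  have -> : l = fun s => \sum_i ccrd i (l s) *: cvec (c := cs) i.
    by apply/funext => s; exact: ccrdE.
  apply: is_derive_bigsum => i; apply: is_derive1_scalel.
  apply: DeriveDef; first by have /derivable1P := dK i.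
  by rewrite [RHS]derive_lineE.
have [dl1 dl2] := dl.
have dld : differentiable l (0 : R) by exact/derivable1_diffP.
have dfl : differentiable f (l 0) by rewrite l0.
have dc : differentiable (f \o l) (0 : R) by exact: differentiable_comp.
apply: DeriveDef; first by apply/derivable1P/derivable1_diffP.
have E1 : 'd l (0 : R) (1 : R) = \sum_i 'D_v (ccrd i \o K) z *: cvec (c := cs) i.
  by rewrite -dl2 deriveE.
rewrite derive_lineE; transitivity ('d f (l 0) ('d l (0 : R) (1 : R))).
  have -> : (fun h => (f \o K) (h *: v + z)) = f \o l by [].
  by rewrite deriveE // diff_comp.
rewrite E1 l0 linear_sum.
apply: eq_bigr => i _; rewrite linearZ.
by have -> : 'D_(cvec (c := cs) i) f (K z) = 'd f (K z) (cvec i) by exact: deriveE.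
Qed.

Definition smooth_map U K := forall i, smooth_on U (ccrd (c := cs) i \o K).

Lemma smooth_map_cont U K z : smooth_map U K -> U z -> {for z, continuous K}.
Proof.
move=> HK Uz; have -> : K = fun x => \sum_i ccrd i (K x) *: cvec (c := cs) i.
  by apply/funext => x; exact: ccrdE.
apply: cvg_bigsum => i.
by apply: cvgZr_tmp; exact: smooth_cont (HK i) Uz.
Qed.

(** The induction keeps [f] free, because the derivative of [f \o K] contains the compositions of
    the partial derivatives of [f] with the same [K]. *)
Lemma Ck_comp k U (W : set E) f K : open U -> open W -> (forall z, U z -> W (K z)) ->
  (forall i, Ck_on k U (ccrd (c := cs) i \o K)) -> Ck_on k W f -> Ck_on k U (f \o K).
Proof.
move=> oU oW KW; elim: k f => [|k IH] f HK Hf; split=> //=.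
- move=> z Uz; apply: continuous_comp; last exact: (Ck_cont Hf (KW z Uz)).
  have -> : K = fun x => \sum_i ccrd i (K x) *: cvec (c := cs) i.
    by apply/funext => x; exact: ccrdE.
  apply: cvg_bigsum => i.
  by apply: cvgZr_tmp; exact: Ck_cont (HK i) Uz.
- move=> z Uz; apply: continuous_comp; last exact: (Ck_cont Hf (KW z Uz)).
  have -> : K = fun x => \sum_i ccrd i (K x) *: cvec (c := cs) i.
    by apply/funext => x; exact: ccrdE.
  apply: cvg_bigsum => i.
  by apply: cvgZr_tmp; exact: Ck_cont (HK i) Uz.
move=> v.
have Hf1 : Ck_on 1 W f by elim: {IH} k HK Hf => [//|k IH] HK Hf; apply: IH => [i|]; exact: Ck_weak.
have D z : U z -> is_derive z v (f \o K)
    (\sum_i 'D_v (ccrd i \o K) z * 'D_(cvec (c := cs) i) f (K z)).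
  move=> Uz; apply: is_derive_comp => [|i]; last exact: Ck_derivable (HK i) Uz.
  exact: C1_differentiable cs _ _ _ oW Hf1 (KW z Uz).
split=> [z /D[]//|].
apply: (@Ck_ext _ _ _ _ (fun z => \sum_i 'D_v (ccrd i \o K) z * 'D_(cvec (c := cs) i) f (K z))) => //.
  by move=> z /D[].
apply: Ck_sum => // i _; apply: Ck_mul => //; first exact: Ck_derive.
have IH' := IH (fun y => 'D_(cvec (c := cs) i) f y).
by apply: IH' => [j|]; [exact: Ck_weak (HK j)|exact: Ck_derive].
Qed.

Lemma smooth_comp U (W : set E) f K : open U -> open W -> (forall z, U z -> W (K z)) ->
  smooth_map U K -> smooth_on W f -> smooth_on U (f \o K).
Proof. by move=> oU oW KW HK Hf k; apply: Ck_comp KW _ _ => // i; exact: HK. Qed.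

End ChainRule.

Section CoordinateInstances.
Context {R : realType}.

Definition coords_real : coords R.
Proof.
apply: (@Coords R R unit (fun=> 1) (fun=> [the {linear R -> R} of idfun])) => [i x|v].
  exact: cvg_id.
by rewrite big_const card_unit /= addr0 /GRing.scale /= mulr1.
Defined.

Lemma coord_linear n (i : 'I_n) : linear (fun v : 'rV[R]_n => v ord0 i : R).
Proof. by move=> a u v; rewrite !mxE. Qed.

Definition coord_row n (i : 'I_n) : {linear 'rV[R]_n -> R} :=
  HB.pack (fun v : 'rV[R]_n => v ord0 i : R)
    (GRing.isLinear.Build _ _ _ _ _ (coord_linear (n := n) i)).

Definition coords_row n : coords 'rV[R]_n.
Proof.
apply: (@Coords R 'rV[R]_n 'I_n (fun i => delta_mx ord0 i) (@coord_row n)) => [i x|v].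
  exact: coord_continuous.
exact: row_sum_delta.
Defined.

Definition coords_prod (E1 E2 : normedModType R) (c1 : coords E1) (c2 : coords E2) :
  coords (E1 * E2)%type.
Proof.
apply: (@Coords R (E1 * E2)%type (cdim c1 + cdim c2)%type
  (fun i => match i with inl i => (cvec i, 0) | inr i => (0, cvec i) end)
  (fun i => match i with
    | inl i => [the {linear (E1 * E2)%type -> R} of ccrd i \o fst]
    | inr i => [the {linear (E1 * E2)%type -> R} of ccrd i \o snd] end)).
  case=> i x; apply: continuous_comp; try exact: ccrd_cont.
  - exact: cvg_fst.
  - exact: cvg_snd.
case=> v1 v2; rewrite big_sumType /=.
rewrite {1}[v1](ccrdE c1) {1}[v2](ccrdE c2).
have -> (r : seq (cdim c1)) : \sum_(i <- r) ccrd i v1 *: ((cvec i, 0) : E1 * E2) =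
    (\sum_(i <- r) ccrd i v1 *: cvec i, 0).
  elim: r => [|i r IH]; first by rewrite !big_nil.
  by rewrite !big_cons IH; congr pair; rewrite /= scaler0 addr0.
have -> (r : seq (cdim c2)) : \sum_(i <- r) ccrd i v2 *: ((0, cvec i) : E1 * E2) =
    (0, \sum_(i <- r) ccrd i v2 *: cvec i).
  elim: r => [|i r IH]; first by rewrite !big_nil.
  by rewrite !big_cons IH; congr pair; rewrite /= scaler0 addr0.
by congr pair; rewrite /= ?addr0 ?add0r.
Defined.

End CoordinateInstances.

(** * Symmetry of second derivatives *)

Section Schwarz.
Context {R : realType} {E : normedModType R}.
Implicit Types (f : E -> R) (U : set E).

Lemma derive_shiftE f (c x v : E) : 'D_v (fun y => f (y + c)) x = 'D_v f (x + c).
Proof.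
rewrite /derive; set g1 := fun h => h^-1 *: _; set g2 := fun h => h^-1 *: _.
suff -> : g1 = g2 by [].
by apply/funext => h; rewrite /g1 /g2 /= addrA.
Qed.

Lemma derivable_shift f (c x v : E) : derivable f (x + c) v ->
  derivable (fun y => f (y + c)) x v.
Proof.
rewrite /derivable; set g1 := fun h => h^-1 *: _; set g2 := fun h => h^-1 *: _.
suff -> : g1 = g2 by [].
by apply/funext => h; rewrite /g1 /g2 /= addrA.
Qed.

(* The second difference is symmetric in [u] and [v]. *)
Lemma double_difference U f z u v : Ck_on 2 U f ->
  (forall a b : R, 0 <= a <= 1 -> 0 <= b <= 1 -> U (z + a *: u + b *: v)) ->
  exists a b : R, [/\ 0 <= a <= 1, 0 <= b <= 1 &
    f (z + u + v) - f (z + u) - (f (z + v) - f z) =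
    'D_v (fun x => 'D_u f x) (z + a *: u + b *: v)].
Proof.
move=> Hf HU; pose g x := f (x + v) - f x.
have HU0 (a : R) : 0 <= a <= 1 -> U (z + a *: u).
  by move=> a01; have := HU a 0 a01; rewrite scale0r addr0 lexx ler01; apply.
have HU1 (a : R) : 0 <= a <= 1 -> U (z + a *: u + v).
  by move=> a01; have := HU a 1 a01; rewrite scale1r lexx ler01; apply.
have dg (a : R) : 0 <= a <= 1 -> is_derive (z + a *: u) u g
    ('D_u f (z + a *: u + v) - 'D_u f (z + a *: u)).
  move=> a01; rewrite -derive_shiftE; apply: is_deriveB.
    by apply: DeriveDef => //; apply: derivable_shift; exact: Ck_derivable Hf (HU1 a a01).
  by apply: DeriveDef => //; exact: Ck_derivable Hf (HU0 a a01).
have [a a01 Ea] : exists2 t : R, 0 <= t <= 1 & g (z + u) - g z = 'D_u g (z + t *: u).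
  by apply: mvt_line => t /dg[].
have [_ Da] := dg a a01.
have [b b01 Eb] : exists2 t : R, 0 <= t <= 1 &
    'D_u f (z + a *: u + v) - 'D_u f (z + a *: u) =
    'D_v (fun x => 'D_u f x) (z + a *: u + t *: v).
  apply: (@mvt_line _ _ (fun x => 'D_u f x)) => t t01.
  by have := Ck_derivable (Ck_derive u Hf) (HU a t a01 t01); apply.
by exists a, b; split=> //; rewrite -Eb -Da -Ea.
Qed.

Lemma derive2_scale U f (t : R) x y w : open U -> Ck_on 2 U f -> U w ->
  'D_(t *: y) (fun a => 'D_(t *: x) f a) w = t * (t * 'D_y (fun a => 'D_x f a) w).
Proof.
move=> oU Hf Uw.
have tD : forall a, U a -> t * 'D_x f a = 'D_(t *: x) f a.
    by move=> a Ua; have [_ ->] := derive_scale t (Ck_derivable (v := x) Hf Ua).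
have dx := Ck_derivable (v := y) (Ck_derive x Hf) Uw.
have [dtx Etx] := derive_scale t dx.
have dM : is_derive w (t *: y) (t \*: (fun a => 'D_x f a : R)) (t *: (t * 'D_y (fun a => 'D_x f a) w)).
    by rewrite -Etx; apply: is_deriveZ.
have [d1 d2] := dM.
have [_ ->] := derive_eq_in oU Uw tD d1.
  exact: d2.
Qed.

(** The second difference with sides [t *: u] and [t *: v], read in the two orders, equals [t * t]
    times each mixed derivative at some point of the parallelogram. After cancelling [t * t],
    continuity at [z] makes the two derivatives differ there by less than any [e]. *)
Lemma schwarz U f z u v : open U -> Ck_on 2 U f -> U z ->
  'D_u (fun x => 'D_v f x) z = 'D_v (fun x => 'D_u f x) z.
Proof.
move=> oU Hf Uz; apply/eqP; rewrite -subr_eq0 -normr_le0.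
apply/ler_addgt0Pl => e e0; rewrite addr0.
have e2 : 0 < e / 2 by rewrite divr_gt0.
have /cvgrPdist_lt/(_ _ e2) H1 := Ck_cont (Ck_derive u (Ck_derive v Hf)) Uz.
have /cvgrPdist_lt/(_ _ e2) H2 := Ck_cont (Ck_derive v (Ck_derive u Hf)) Uz.
have H0 : \forall w \near z, U w by exact: open_nbhs_nbhs.
have [d d0 Hd] := (nbhs_normP _ _).1 (filterI H0 (filterI H1 H2)).
(* The summand 1 keeps [m] positive when both vectors vanish; [t * m = d / 2] keeps the
   parallelogram strictly inside the ball of radius [d]. *)
pose m : R := `|u| + `|v| + 1.
have m0 : 0 < m by rewrite ltr_wpDl // addr_ge0.
pose t : R := d / 2 / m.
have t0 : 0 < t by rewrite !divr_gt0.
have tm : t * m = d / 2 by rewrite divfK // gt_eqF.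
have mE : m = `|u| + (`|v| + 1) by rewrite addrA.
clearbody t; clearbody m.
have inb (a b : R) : 0 <= a <= 1 -> 0 <= b <= 1 ->
    ball_ Num.norm z d (z + a *: (t *: u) + b *: (t *: v)).
  move=> /andP[a0 a1] /andP[b0 b1] /=; rewrite -addrA opprD addrA subrr sub0r normrN.
  apply: le_lt_trans (_ : t * m < d).
    apply: le_trans (ler_normD _ _) _; rewrite !normrZ !ger0_norm // ?(ltW t0) //.
    rewrite mE !mulrDr mulr1; apply: lerD.
      by rewrite ler_piMl // mulr_ge0 // ltW.
    by apply: le_trans (_ : t * `|v| <= _); [rewrite ler_piMl // mulr_ge0 // ltW|rewrite lerDl ltW].
  by rewrite tm ltr_pdivrMr // mulr_natr mulr2n ltrDl.
have inb' (a b : R) : 0 <= a <= 1 -> 0 <= b <= 1 ->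
    ball_ Num.norm z d (z + a *: (t *: v) + b *: (t *: u)).
  by move=> a01 b01; rewrite addrAC; exact: inb.
have HU (a b : R) : 0 <= a <= 1 -> 0 <= b <= 1 -> U (z + a *: (t *: u) + b *: (t *: v)).
  by move=> a01 b01; have [] := Hd _ (inb a b a01 b01).
have HU' (a b : R) : 0 <= a <= 1 -> 0 <= b <= 1 -> U (z + a *: (t *: v) + b *: (t *: u)).
  by move=> a01 b01; have [] := Hd _ (inb' a b a01 b01).
have DD x y w Uw := derive2_scale (w := w) t x y oU Hf Uw.
have [a [b [a01 b01]]] := double_difference Hf HU.
rewrite DD; last exact: HU.
have [a' [b' [a01' b01']]] := double_difference Hf HU'.
rewrite DD; last exact: HU'.
have -> : f (z + t *: v + t *: u) - f (z + t *: v) - (f (z + t *: u) - f z) =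
    f (z + t *: u + t *: v) - f (z + t *: u) - (f (z + t *: v) - f z).
  by rewrite [z + t *: v + t *: u]addrAC; ring.
move=> -> /(mulfI (lt0r_neq0 t0)) /(mulfI (lt0r_neq0 t0)) EE.
have [_ [_ {}H1]] := Hd _ (inb a b a01 b01).
have [_ [{}H2 _]] := Hd _ (inb' a' b' a01' b01').
move: H2; rewrite /= EE => H2; rewrite /= in H1.
rewrite ltW // (splitr e).
apply: le_lt_trans (ler_distD _ _ _) _; apply: ltrD; first exact: H2.
by rewrite distrC; exact: H1.
Qed.

End Schwarz.

(** * Integrals depending on a parameter *)

Section UnitIntegral.
Context {R : realType}.
Implicit Types (g G : R -> R).

(** Retraction of the line onto [0, 1], used to extend integrands and homotopies continuously to all
    real times. *)
Definition clamp (t : R) : R := Num.max 0 (Num.min 1 t).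

Lemma clamp_in t : 0 <= clamp t <= 1.
Proof.
by rewrite /clamp le_max lexx /= ge_max ler01 /= ge_min lexx.
Qed.

Lemma clamp_id t : 0 <= t <= 1 -> clamp t = t.
Proof. by move=> /andP[t0 t1]; rewrite /clamp min_r // max_r. Qed.

Lemma clamp_continuous : continuous clamp.
Proof.
move=> t; apply: continuous_max; first exact: cst_continuous.
by apply: continuous_min; [exact: cst_continuous|exact: cvg_id].
Qed.

(** The derivative is two-sided also at 0 and 1, so the values of [G] just outside the segment
    matter. *)
Definition antiderivative g G := forall t : R, 0 <= t <= 1 -> is_derive t (1 : R) G (g t).

Lemma antiderivative_exists g : (forall t : R, 0 <= t <= 1 -> {for t, continuous g}) ->
  exists G, antiderivative g G.
Proof.
move=> gc; pose h := g \o clamp.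
have hc : continuous h.
  by move=> t; apply: continuous_comp; [exact: clamp_continuous|exact/gc/clamp_in].
have hi : (@lebesgue_measure R).-integrable `[-1, 2] (EFin \o h).
  apply: continuous_compact_integrable; first exact: segment_compact.
  exact: continuous_subspaceT.
(* The ends -1 and 2 only serve to make every point of [0, 1] interior, where the fundamental
   theorem gives a two-sided derivative. *)
exists (fun x : R => (\int[lebesgue_measure]_(t in `[-1, x]) h t)%R) => t t01.
have := @continuous_FTC1_closed R h (-1) t 2.
move=> /(_ _ hi _ (hc t)); case.
- by case/andP: t01 => _ t1; rewrite (le_lt_trans t1) // ltr1n.
- by case/andP: t01 => t0 _; rewrite (lt_le_trans _ t0) // ltrN10.
move=> d1 d2; apply: DeriveDef => //.
by rewrite -derive1E d2 /h /= clamp_id.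
Qed.

(* Meaningless (but total) when [g] has no antiderivative on [0, 1]. *)
Definition int01 g : R := let G := get (antiderivative g) in G 1 - G 0.

Lemma int01E g G : antiderivative g G -> int01 g = G 1 - G 0.
Proof.
move=> HG; rewrite /int01; set K := get _.
have HK : antiderivative g K by exact: (@getI _ (antiderivative g) G).
have dl (t : R) : t \in `]0, 1[ -> is_derive t (1 : R) (K - G) (g t - g t).
  rewrite in_itv /= => /andP[t0 t1].
  by apply: is_deriveB; [apply: HK|apply: HG]; rewrite !ltW.
have [|c _] := @MVT_segment R (K - G) (fun t => g t - g t) 0 1 ler01 dl.
  apply: derivable_within_continuous => t; rewrite in_itv /= => t01.
  by apply: derivableB; [have [] := HK t t01|have [] := HG t t01].
rewrite subrr mul0r => /eqP; rewrite subr_eq0 => /eqP E.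
have {}E : K 1 - G 1 = K 0 - G 0 := E.
by clear -E; lra.
Qed.

Lemma int01_bound g G (M : R) : antiderivative g G ->
  (forall t, 0 <= t <= 1 -> `|g t| <= M) -> `|int01 g| <= M.
Proof.
move=> HG HM; rewrite (int01E HG).
have dl (t : R) : t \in `]0, 1[ -> is_derive t (1 : R) G (g t).
  by rewrite in_itv /= => /andP[t0 t1]; apply: HG; rewrite !ltW.
have [|c c01 ->] := @MVT_segment R G g 0 1 ler01 dl.
  apply: derivable_within_continuous => t; rewrite in_itv /= => t01.
  by have [] := HG t t01.
by rewrite subr0 mulr1 HM.
Qed.

Lemma antiderivative_lin (a : R) g1 g2 G1 G2 : antiderivative g1 G1 ->
  antiderivative g2 G2 ->
  antiderivative (fun t => a * g1 t + g2 t) (fun t => a * G1 t + G2 t).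
Proof.
move=> H1 H2 t t01.
by have := is_deriveD (is_deriveZ a (H1 t t01)) (H2 t t01).
Qed.

Lemma int01_lin (a : R) g1 g2 : (forall t : R, 0 <= t <= 1 -> {for t, continuous g1}) ->
  (forall t : R, 0 <= t <= 1 -> {for t, continuous g2}) ->
  int01 (fun t => a * g1 t + g2 t) = a * int01 g1 + int01 g2.
Proof.
move=> /antiderivative_exists[G1 H1] /antiderivative_exists[G2 H2].
rewrite (int01E (antiderivative_lin a H1 H2)) (int01E H1) (int01E H2); ring.
Qed.

Lemma int01_sub g1 g2 : (forall t : R, 0 <= t <= 1 -> {for t, continuous g1}) ->
  (forall t : R, 0 <= t <= 1 -> {for t, continuous g2}) ->
  int01 g1 - int01 g2 = int01 (fun t => g1 t - g2 t).
Proof.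
move=> c1 c2; have -> : (fun t => g1 t - g2 t) = fun t => -1 * g2 t + g1 t.
  by apply/funext => t; rewrite mulN1r addrC.
by rewrite int01_lin // mulN1r addrC.
Qed.

End UnitIntegral.

Section ParametricIntegral.
Context {R : realType} {E : normedModType R}.
Variables (O : set (R * E)).
Hypothesis oO : open O.

Definition tube : set E := [set z | forall t : R, 0 <= t <= 1 -> O (t, z)].

(** Tube lemma: compactness of [0, 1] makes a condition that holds near each point of the segment
    over [z] hold uniformly in [t]. *)
Lemma near_unit (z : E) (P : E -> R -> Prop) :
  (forall t : R, 0 <= t <= 1 -> \forall p \near (t, z), P p.2 p.1) ->
  \forall x \near z, forall t : R, 0 <= t <= 1 -> P x t.
Proof.
move=> H.
have /compact_near_coveringP/(_ E (nbhs z) P) C := @segment_compact R 0 1.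
have : \forall x \near z, `[0, 1] `<=` P x.
  apply: C => t; rewrite /= in_itv /= => t01.
  exact: H t t01.
by apply: filterS => x Hx t t01; apply: Hx; rewrite /= in_itv.
Qed.

Lemma tube_open : open tube.
Proof.
rewrite openE => z Oz; apply: (@near_unit z (fun x t => O (t, x))) => t t01.
have H : nbhs (t, z) O by exact: open_nbhs_nbhs (conj oO (Oz t t01)).
by apply: filterS H => -[s x].
Qed.

Lemma slice_cont (g : R * E -> R) z t : tube z -> 0 <= t <= 1 -> Ck_on 0 O g ->
  {for t, continuous (fun s => g (s, z))}.
Proof.
move=> Vz t01 Hg; apply: (@continuous_comp _ _ _ (fun s : R => (s, z)) g).
  by apply: (@cvg_pair _ _ _ (nbhs t) (nbhs t) (nbhs z)); [exact: cvg_id|exact: cvg_cst].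
exact: (Ck_cont Hg (Vz t t01)).
Qed.

Lemma near_slices (g : R * E -> R) z (e : R) : tube z -> Ck_on 0 O g -> 0 < e ->
  \forall x \near z, forall t, 0 <= t <= 1 -> `|g (t, x) - g (t, z)| <= e.
Proof.
move=> Vz Hg e0; apply: (@near_unit z (fun x t => `|g (t, x) - g (t, z)| <= e)) => t t01.
have e2 : 0 < e / 2 by rewrite divr_gt0.
have /cvgrPdist_lt/(_ _ e2) H1 := Ck_cont Hg (Vz t t01).
have /cvgrPdist_lt/(_ _ e2) H2 := slice_cont Vz t01 Hg.
have H3 : nbhs (t, z) (fun p : R * E => `|g (t, z) - g (p.1, z)| < e / 2).
  exact: (@cvg_fst R E (nbhs t) (nbhs z) _ _ H2).
apply: filterS2 H1 H3 => -[s x] /= A B.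
rewrite ltW // (splitr e); apply: le_lt_trans (ler_distD (g (t, z)) _ _) _.
by rewrite distrC; apply: ltrD.
Qed.

Lemma int01_param_cont (g : R * E -> R) z : Ck_on 0 O g -> tube z ->
  {for z, continuous (fun x => int01 (fun t => g (t, x)))}.
Proof.
move=> Hg Vz; apply/cvgrPdist_le => e e0.
have := near_slices Vz Hg e0.
have Vnear : \forall x \near z, tube x by exact: open_nbhs_nbhs (conj tube_open Vz).
apply: filterS2 Vnear => x Vx Hx.
have c1 t : 0 <= t <= 1 -> {for t, continuous (fun s => g (s, z))}.
  by move=> t01; exact: slice_cont Vz t01 Hg.
have c2 t : 0 <= t <= 1 -> {for t, continuous (fun s => g (s, x))}.
  by move=> t01; exact: slice_cont Vx t01 Hg.
rewrite distrC.
have -> : int01 (fun t => g (t, x)) - int01 (fun t => g (t, z)) =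
    int01 (fun t => (-1) * g (t, z) + g (t, x)).
  by rewrite int01_lin // mulN1r addrC.
have [G1 H1] := antiderivative_exists c1; have [G2 H2] := antiderivative_exists c2.
apply: int01_bound (antiderivative_lin (-1) H1 H2) _ => t t01.
by rewrite mulN1r addrC; exact: Hx.
Qed.

(** By the mean value theorem along [(0, v)], the difference quotient at time [t] is [Dg] at an
    intermediate point; [near_slices] makes it close to [Dg (t, z)] uniformly in [t], so the
    integrals converge. *)
Lemma int01_param_derive (g : R * E -> R) z v : Ck_on 1 O g -> tube z ->
  is_derive z v (fun x => int01 (fun t => g (t, x)))
    (int01 (fun t => 'D_((0, v) : R * E) g (t, z))).
Proof.
move=> Hg Vz; pose Dg p := 'D_((0, v) : R * E) g p.
have HDg : Ck_on 0 O Dg by exact: Ck_derive.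
have Hg0 : Ck_on 0 O g by exact: Ck_weak.
suff H : (fun h : R => h^-1 *: (((fun x => int01 (fun t => g (t, x))) \o shift z) (h *: v)
    - int01 (fun t => g (t, z)))) @ 0^' --> int01 (fun t => Dg (t, z)).
  by apply: DeriveDef; [apply/cvg_ex; eexists; exact: H|exact: cvg_lim H].
apply/cvgrPdist_le => e e0.
have Vnear : \forall x \near z, tube x by exact: open_nbhs_nbhs (conj tube_open Vz).
have [d d0 Hd] := (nbhs_normP _ _).1 (filterI Vnear (near_slices Vz HDg e0)).
have hn : \forall h \near (0 : R)^', `|h| * `|v| < d.
  apply: cvg_within; have [->|v0] := eqVneq v 0.
    by apply: filterE => h; rewrite normr0 mulr0.
  have dv : 0 < d / `|v| by rewrite divr_gt0 ?normr_gt0.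
  have := nbhs0_lt (V := R) dv.
  by apply: filterS => h; rewrite ltr_pdivlMr ?normr_gt0.
have hn0 : \forall h \near (0 : R)^', h != 0 by exact: nbhs_dnbhs_neq.
apply: filterS2 hn hn0 => h hv h0.
have Hs (s : R) : 0 <= s <= 1 -> ball_ Num.norm z d (z + s *: (h *: v)).
  move=> /andP[s0 s1] /=; rewrite opprD addrA subrr sub0r normrN !normrZ.
  by apply: le_lt_trans hv; rewrite (ger0_norm s0) ler_piMl // mulr_ge0.
have [V1 _] : tube (h *: v + z) /\ True.
  by have := Hs 1; rewrite scale1r addrC lexx ler01 => /(_ isT) /Hd[].
have c1 t : 0 <= t <= 1 -> {for t, continuous (fun s => g (s, z))}.
  by move=> t01; exact: slice_cont Vz t01 Hg0.
have c2 t : 0 <= t <= 1 -> {for t, continuous (fun s => g (s, h *: v + z))}.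
  by move=> t01; exact: slice_cont V1 t01 Hg0.
have c3 t : 0 <= t <= 1 -> {for t, continuous (fun s => Dg (s, z))}.
  by move=> t01; exact: slice_cont Vz t01 HDg.
have [G1 H1] := antiderivative_exists c1.
have [G2 H2] := antiderivative_exists c2.
have [G3 H3] := antiderivative_exists c3.
have H12 := antiderivative_lin (-1) H1 H2.
have H123 := antiderivative_lin (- h^-1) H12 H3.
(* The whole error is written as one integral whose integrand has the explicit antiderivative of
   [H123], so a pointwise bound suffices. *)
have -> : int01 (fun t => Dg (t, z)) - h^-1 *: (((fun x => int01 (fun t => g (t, x)))
     \o shift z) (h *: v) - int01 (fun t => g (t, z))) =
  int01 (fun t => - h^-1 * (-1 * g (t, z) + g (t, h *: v + z)) + Dg (t, z)).
  rewrite /= (int01E H123) (int01E H1) (int01E H2) (int01E H3) /GRing.scale /=; ring.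
apply: int01_bound H123 _ => t t01.
have Os (s : R) : 0 <= s <= 1 -> O ((t, z) + s *: (h *: ((0, v) : R * E))).
  move=> /Hs/Hd[/(_ t t01) + _]; congr (O _).
  by congr pair; rewrite /= ?scaler0 ?addr0.
have [s s01] : exists2 s : R, 0 <= s <= 1 &
    g ((t, z) + h *: ((0, v) : R * E)) - g (t, z) =
    'D_(h *: ((0, v) : R * E)) g ((t, z) + s *: (h *: ((0, v) : R * E))).
  apply: mvt_line => s s01.
  by have [] := derive_scale h (Ck_derivable (v := (0, v)) Hg (Os s s01)).
have [_ ->] := derive_scale h (Ck_derivable (v := (0, v)) Hg (Os s s01)).
have -> : (t, z) + h *: ((0, v) : R * E) = (t, h *: v + z).
  by congr pair; rewrite /= ?scaler0 ?addr0 // addrC.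
have -> : (t, z) + s *: (h *: ((0, v) : R * E)) = (t, z + s *: (h *: v)).
  by congr pair; rewrite /= ?scaler0 ?addr0.
move=> Em; rewrite mulN1r [- g _ + _]addrC Em mulrA mulNr mulVf // mulN1r addrC distrC.
by have [_] := Hd _ (Hs s s01); apply.
Qed.

Lemma Ck_int01 k (g : R * E -> R) : Ck_on k O g ->
  Ck_on k tube (fun x => int01 (fun t => g (t, x))).
Proof.
elim: k g => [|k IH] g Hg.
  by split=> // z Vz; exact: int01_param_cont Hg Vz.
have Hg1 : Ck_on 1 O g by elim: {IH} k Hg => [//|k IH] Hg; apply: IH; exact: Ck_weak.
split=> [z Vz|v]; first by apply: int01_param_cont Vz; exact: Ck_weak.
split=> [z Vz|]; first by have [] := int01_param_derive v Hg1 Vz.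
apply: (@Ck_ext _ _ _ _ (fun x => int01 (fun t => 'D_((0, v) : R * E) g (t, x)))).
- exact: tube_open.
- by move=> z Vz; have [] := int01_param_derive v Hg1 Vz.
- by apply: (IH (fun p => 'D_((0, v) : R * E) g p)); exact: Ck_derive.
Qed.

Lemma smooth_int01 (g : R * E -> R) : smooth_on O g ->
  smooth_on tube (fun x => int01 (fun t => g (t, x))).
Proof. by move=> Hg k; exact: Ck_int01. Qed.

End ParametricIntegral.

(** * Bump functions and partitions of unity *)

Section Bump.
Context {R : realType}.

(* The factor [x ^- n] makes the family stable under differentiation. *)
Definition flat (n : nat) (x : R) : R :=
  if 0 < x then (x^-1) ^+ n * expR (- x^-1) else 0.

Lemma flat_ge0 n x : 0 <= flat n x.
Proof.
rewrite /flat; case: ifP => // x0.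
by rewrite mulr_ge0 // ?expR_ge0 // exprn_ge0 // invr_ge0 ltW.
Qed.

Lemma flat_gt0 n x : 0 < x -> 0 < flat n x.
Proof. by move=> x0; rewrite /flat x0 mulr_gt0 ?expR_gt0 // exprn_gt0 // invr_gt0. Qed.

Lemma flat_eq0 n x : x <= 0 -> flat n x = 0.
Proof. by rewrite /flat leNgt => /negbTE ->. Qed.

(** With [m = n + 1], [expR x^-1] is the [m]-th power of [expR (x^-1 / m)], which exceeds
    [x^-1 / m]; hence it dominates the [m]-th power of [x^-1] up to the constant [m ^+ m]. *)
Lemma flat_bound n : exists2 C : R, 0 < C & forall x, 0 < x -> flat n x <= C * x.
Proof.
pose m : R := n.+1%:R; have m0 : 0 < m by rewrite ltr0n.
exists (m ^+ n.+1) => [|x x0]; first exact: exprn_gt0.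
rewrite /flat x0 expRN ler_pdivrMr ?expR_gt0 //.
have y0 : 0 <= x^-1 / m by rewrite divr_ge0 ?invr_ge0 ?(ltW x0) ?(ltW m0).
have H : (x^-1 / m) ^+ n.+1 <= expR x^-1.
  have -> : expR x^-1 = expR (x^-1 / m) ^+ n.+1.
    by rewrite -expRM_natl mulrC divfK // gt_eqF.
  by rewrite lerXn2r ?nnegrE ?expR_ge0 // (le_trans _ (expR_ge1Dx _)) // lerDr.
have -> : (x^-1) ^+ n = m ^+ n.+1 * x * (x^-1 / m) ^+ n.+1.
  rewrite expr_div_n [RHS]mulrC mulrA divfK ?expf_neq0 ?gt_eqF // exprSr.
  by rewrite divfK // gt_eqF.
by rewrite ler_wpM2l // mulr_ge0 ?exprn_ge0 // ltW.
Qed.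

Lemma flatS n x : flat n x = x * flat n.+1 x.
Proof.
rewrite /flat; case: ifP => [x0|]; last by rewrite mulr0.
by rewrite exprS !mulrA divff ?gt_eqF // mul1r.
Qed.

(** For [x > 0] this is the product rule. At 0 the difference quotient for [h > 0] is [flat n.+1 h]
    by [flatS], which [flat_bound] sends to 0. *)
Lemma is_derive_flat n x :
  is_derive x (1 : R) (flat n) (- n%:R * flat n.+1 x + flat n.+2 x).
Proof.
have [x0|x0|x0] := ltgtP x 0.
- rewrite !flat_eq0 ?(ltW x0) // mulr0 addr0.
  have E : \near x, cst 0 x = flat n x.
    near=> y; rewrite flat_eq0 //= ltW //; near: y; exact: lt_nbhsl.
  exact: near_eq_is_derive E (is_derive_cst _ _ _).
- have xn : x != 0 by rewrite gt_eqF.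
  have dV : is_derive x (1 : R) (fun y : R => y^-1) (- x ^- 2).
    have did : derivable (@id R) x 1 by exact: derivable_id.
    apply: DeriveDef; first exact: (@derivableV _ _ id).
    by rewrite (@deriveV _ _ id) // derive_id /GRing.scale /= mulr1.
  have dN : is_derive x (1 : R) (fun y : R => - y^-1) (x ^- 2).
    by rewrite -[x ^- 2]opprK; exact: is_deriveN.
  have dE : is_derive x (1 : R) (fun y : R => expR (- y^-1)) (expR (- x^-1) * x ^- 2).
    exact: (@is_derive1_comp _ expR (fun y : R => - y^-1) x _ _ _ dN).
  have dP := is_deriveX n dV.
  have := is_deriveM dP dE.
  have E : \near x, (((fun y : R => y^-1) ^+ n) * (fun y : R => expR (- y^-1))) x = flat n x.
    near=> y; have y0 : 0 < y by near: y; exact: lt_nbhsr.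
    by rewrite /flat y0 /=; congr (_ * _); rewrite exprfctE.
  move=> /(near_eq_is_derive E)[d1 d2]; apply: DeriveDef => //; rewrite d2.
  rewrite /flat x0 /GRing.scale /= exprfctE.
  case: n {dP E d1 d2} => [|n] /=; first by rewrite !expr0; field.
  rewrite !exprS; field.
  by rewrite xn.
- rewrite x0 !flat_eq0 // mulr0 addr0.
  have [C C0 HC] := flat_bound n.+1.
  suff H : (fun h : R => h^-1 *: ((flat n \o shift 0) (h *: (1 : R)) - flat n 0)) @ 0^' --> (0 : R).
    by apply: DeriveDef; [apply/cvg_ex; eexists; exact: H|exact: cvg_lim H].
  apply/cvgrPdist_le => e e0; apply: cvg_within.
  have eC : 0 < e / C by rewrite divr_gt0.
  have := nbhs0_lt (V := R) eC.
  apply: filterS => h; rewrite ltr_pdivlMr // => hC.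
  rewrite /= sub0r normrN addr0 [h *: 1]mulr1 (flat_eq0 _ (lexx 0)) subr0 /GRing.scale /=.
  have [h0|h0] := ltP 0 h; last by rewrite flat_eq0 // mulr0 normr0 ltW.
  rewrite flatS mulrA mulVf ?gt_eqF // mul1r ger0_norm ?flat_ge0 //.
  apply: le_trans (HC _ h0) _; rewrite mulrC ltW //.
  by rewrite (gtr0_norm h0) in hC.
Unshelve. all: by end_near. Qed.

Lemma smooth_flat n : smooth_on setT (flat n).
Proof.
have cont m x : {for x, continuous (flat m)}.
  apply/differentiable_continuous/derivable1_diffP.
  by have [] := is_derive_flat m x.
have D m x v : is_derive x v (flat m) (v * (- m%:R * flat m.+1 x + flat m.+2 x)).
  have [d1 <-] := is_derive_flat m x.
  have [d2 <-] := derive_scale v d1.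
  by apply: DeriveDef; rewrite /GRing.scale /= mulr1 in d2 *.
move=> k; elim: k n => [|k IH] n; split=> //= v.
split=> [z _|]; first by have [] := D n z v.
apply: (@Ck_ext _ _ _ _ (fun x => v * (- n%:R * flat n.+1 x + flat n.+2 x))) => //.
  exact: openT.
  by move=> z _; have [] := D n z v.
have oT : open [set: R] by exact: openT.
apply: Ck_mul => //; first exact: Ck_cst.
by apply: Ck_add => //; apply: Ck_mul => //; exact: Ck_cst.
Qed.

(** Smooth transition from 1 on [s <= 1] to 0 on [s >= 2]. It is one-sided because it is applied to
    squares of normalised distances. *)
Definition step (s : R) : R := flat 0 (2 - s) / (flat 0 (2 - s) + flat 0 (s - 1)).

Lemma step_den s : 0 < flat 0 (2 - s) + flat 0 (s - 1).
Proof.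
have [s2|s2] := ltP s 2.
  by apply: ltr_pwDl; rewrite ?flat_ge0 // flat_gt0 // subr_gt0.
by apply: ltr_wpDl; rewrite ?flat_ge0 // flat_gt0 // subr_gt0 (lt_le_trans _ s2) // ltr1n.
Qed.

Lemma step_ge0 s : 0 <= step s.
Proof. by rewrite divr_ge0 ?flat_ge0 // ltW // step_den. Qed.

Lemma step_le1 s : step s <= 1.
Proof. by rewrite ler_pdivrMr ?step_den // mul1r lerDl flat_ge0. Qed.

Lemma step_eq1 s : s <= 1 -> step s = 1.
Proof.
move=> s1; have := step_den s; rewrite /step [flat 0 (s - 1)]flat_eq0 ?subr_le0 // addr0.
by move=> d0; rewrite divff // gt_eqF.
Qed.

Lemma step_eq0 s : 2 <= s -> step s = 0.
Proof. by move=> s2; rewrite /step flat_eq0 ?subr_le0 // mul0r. Qed.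

Lemma smooth_compR (V : normedModType R) (U : set V) (f : R -> R) (K : V -> R) :
  open U -> smooth_on U K -> smooth_on setT f -> smooth_on U (f \o K).
Proof.
move=> oU HK Hf; apply: (@smooth_comp _ _ _ coords_real U setT) => //.
exact: openT.
Qed.

Lemma smooth_step : smooth_on setT step.
Proof.
have oT : open [set: R] by exact: openT.
have H1 : smooth_on [set: R] (fun s => flat 0 (2 - s)).
  apply: (@smooth_compR _ _ (flat 0)) => //; last exact: smooth_flat.
  apply: smooth_add => //; first exact: smooth_cst.
  by apply: smooth_opp => //; exact: (@smooth_ccrd _ _ coords_real _ tt).
have H2 : smooth_on [set: R] (fun s => flat 0 (s - 1)).
  apply: (@smooth_compR _ _ (flat 0)) => //; last exact: smooth_flat.
  apply: smooth_add => //; last exact: smooth_cst.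
  exact: (@smooth_ccrd _ _ coords_real _ tt).
apply: smooth_mul => //; apply: smooth_inv => // [s _|].
  by rewrite gt_eqF // step_den.
exact: smooth_add.
Qed.

End Bump.

Section PartitionOfUnity.
Context {R : realType} {V : normedModType R} (cs : coords V).

Lemma smooth_prod (U : set V) (I : Type) (r : seq I) (f : I -> V -> R) : open U ->
  (forall i, smooth_on U (f i)) -> smooth_on U (fun z => \prod_(i <- r) f i z).
Proof.
move=> oU H; elim: r => [|i r IH].
  apply: (@smooth_ext _ _ _ (fun=> 1)) => // [z _|]; first by rewrite big_nil.
  exact: smooth_cst.
apply: (@smooth_ext _ _ _ (fun z => f i z * \prod_(i <- r) f i z)) => // [z _|].
  by rewrite big_cons.
exact: smooth_mul.
Qed.

Definition box (a : cdim cs -> R) (r : R) : set V :=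
  [set q | forall i, `|ccrd i q - a i| <= r].

(** Squaring keeps the argument of [step] smooth where an absolute value would not be. Outside the
    box of radius [2 * r] some square exceeds 4, beyond the transition of [step]. *)
Definition bump (a : cdim cs -> R) (r : R) (q : V) : R :=
  \prod_i step (((ccrd i q - a i) / r) ^+ 2).

Lemma bump_ge0 a r q : 0 <= bump a r q.
Proof. by apply: prodr_ge0 => i _; exact: step_ge0. Qed.

Lemma bump_le1 a r q : bump a r q <= 1.
Proof. by apply: prodr_ile1 => i _; rewrite step_ge0 step_le1. Qed.

Lemma smooth_bump a r : smooth_on setT (bump a r).
Proof.
have oT : open [set: V] by exact: openT.
apply: smooth_prod => // i; apply: (@smooth_compR _ _ _ step) => //; last exact: smooth_step.
have H : smooth_on [set: V] (fun q => (ccrd i q - a i) / r).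
  apply: smooth_mul => //; last exact: smooth_cst.
  by apply: smooth_add => //; [exact: smooth_ccrd|exact: smooth_cst].
exact: smooth_mul.
Qed.

Lemma bump_eq1 a r q : 0 < r -> box a r q -> bump a r q = 1.
Proof.
move=> r0 Hq; apply: big1 => i _; apply: step_eq1.
rewrite -real_normK ?num_real // exprn_ile1 // normrM normfV (gtr0_norm r0).
by rewrite ler_pdivrMr // mul1r; exact: Hq.
Qed.

Lemma bump_eq0 a r q i : 0 < r -> 2 * r < `|ccrd i q - a i| -> bump a r q = 0.
Proof.
move=> r0 Hq; rewrite /bump (bigD1 i) //= step_eq0 ?mul0r //.
rewrite -real_normK ?num_real // normrM normfV (gtr0_norm r0).
have : 2 < `|ccrd i q - a i| / r by rewrite ltr_pdivlMr.
by move: (_ / r) => y y2; nra.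
Qed.

Lemma near_box (a : cdim cs -> R) (r : R) (q : V) :
  (forall i, `|ccrd i q - a i| < r) -> \forall x \near q, box a r x.
Proof.
move=> Hq; have H : \forall x \near q, forall i, `|ccrd (c := cs) i x - a i| <= r; last exact: H.
apply: filter_forall => i.
have c : {for q, continuous (fun x => `|ccrd i x - a i|)}.
  apply: continuous_comp; last exact: norm_continuous.
  by apply: continuousB; [exact: ccrd_cont|exact: cst_continuous].
have H : \forall x \near q, `|ccrd (c := cs) i x - a i| < r by exact: (cvgr_lt _ c _ (Hq i)).
by apply: filterS H => x /ltW.
Qed.

Lemma near_not_box (a : cdim cs -> R) (r : R) (q : V) i :
  r < `|ccrd i q - a i| -> \forall x \near q, r < `|ccrd i x - a i|.
Proof.
move=> Hq.
have c : {for q, continuous (fun x => `|ccrd i x - a i|)}.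
  apply: continuous_comp; last exact: norm_continuous.
  by apply: continuousB; [exact: ccrd_cont|exact: cst_continuous].
exact: (cvgr_gt _ c _ Hq).
Qed.

(* Rational boxes: their centres and radii range over a countable type. *)
Let code : countType := ({ffun cdim cs -> rat} * nat)%type.
Let ctr (c : code) (i : cdim cs) : R := ratr (c.1 i).
Let rad (c : code) : R := c.2.+1%:R^-1.

Lemma rational_box (p : V) (N : set V) : nbhs p N -> exists c : code,
  (\forall q \near p, box (ctr c) (rad c) q) /\ box (ctr c) (2 * rad c) `<=` N.
Proof.
move=> /nbhs_normP[d d0 Hd].
pose S : R := 1 + \sum_(i : cdim cs) `|cvec i|.
have S0 : 0 < S by rewrite ltr_wpDr // sumr_ge0.
(* In each coordinate a point of the doubled box is within [2 * r] of the rational centre, itself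
   within [r] of [p]: hence 3. [S] converts bounds on coordinates into a bound on the norm. *)
have e0 : 0 < d / (3 * S) by rewrite divr_gt0 // mulr_gt0.
have [k Hk] : exists k : nat, k.+1%:R^-1 < d / (3 * S).
  have [k _ /(_ k (leqnn k)) Hk] := near_infty_natSinv_lt (PosNum e0).
  by exists k.
pose r : R := k.+1%:R^-1; have r0 : 0 < r by rewrite invr_gt0 ltr0n.
have /choice[a Ha] (i : cdim cs) : exists q : rat, `|ccrd i p - ratr q| < r.
  have [q] := @rat_in_itvoo R (ccrd i p - r) (ccrd i p + r) ltac:(lra).
  rewrite in_itv /= => /andP[q1 q2]; exists q; rewrite ltr_norml; apply/andP; lra.
exists ([ffun i => a i], k); split.
  by apply: near_box => i; rewrite /ctr ffunE.
move=> q Hq; apply: Hd; rewrite /ball_ /= [p - q](ccrdE cs).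
apply: le_lt_trans (ler_norm_sum _ _ _) _.
apply: le_lt_trans (_ : \sum_(i : cdim cs) (3 * r) * `|cvec i| < _).
  apply: ler_sum => i _; rewrite normrZ ler_wpM2r // linearB /=.
  apply: le_trans (ler_distD (ratr (a i)) _ _) _.
  have -> : 3 * r = r + 2 * r by ring.
  apply: lerD; first exact/ltW/Ha.
  by have := Hq i; rewrite /ctr ffunE distrC.
rewrite -mulr_sumr; apply: le_lt_trans (_ : 3 * r * S < _).
  by rewrite ler_wpM2l ?mulr_ge0 // ?(ltW r0) // /S lerDr.
by rewrite mulrAC mulrC -ltr_pdivlMr // mulr_gt0.
Qed.

(* If [rho n] are bumps that are 1 on open sets covering [W], the functions
   [rho n * \prod_(j < n) (1 - rho j)] have telescoping sums and vanish wherever an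
   earlier bump is 1, hence are locally finite. *)
Lemma partition_of_unity (W : set V) (N : V -> set V) :
  (forall p, W p -> nbhs p (N p)) ->
  exists (s : nat -> V -> R) (pt : nat -> V),
    [/\ forall n, smooth_on setT (s n),
        forall n q, 0 <= s n q,
        forall n q, (\forall x \near q, s n x = 0) \/ (W (pt n) /\ N (pt n) q) &
        forall q, W q -> exists m, \forall x \near q,
          \sum_(n < m) s n x = 1 /\ forall n, (m <= n)%N -> s n x = 0].
Proof.
move=> HN.
(* The bumps are enumerated by the codes of rational boxes. A code is kept when its doubled box lies
   in [N p] for some [p] of [W], and [pt n] is such a [p]; at all other indices the bump is 0. *)
pose good (c : code) p := W p /\ box (ctr c) (2 * rad c) `<=` N p.
pose pt n := if unpickle n is Some c then get (good c) else point.
pose okb n := if unpickle n is Some c then `[< exists p, good c p >] else false.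
pose rho n q := if okb n then
  (if unpickle n is Some c then bump (ctr c) (rad c) q else 0) else 0.
have rad0 c : 0 < rad c by rewrite invr_gt0 ltr0n.
have smrho n : smooth_on setT (rho n).
  rewrite /rho; case: (okb n); last exact: smooth_cst.
  by case: (unpickle n) => [c|]; [exact: smooth_bump|exact: smooth_cst].
have rho01 n q : 0 <= rho n q <= 1.
  rewrite /rho; case: (okb n); last by rewrite lexx ler01.
  by case: (unpickle n) => [c|]; rewrite ?bump_ge0 ?bump_le1 ?lexx ?ler01.
pose s n q := rho n q * \prod_(j < n) (1 - rho j q).
have sumE m q : \sum_(n < m) s n q = 1 - \prod_(j < m) (1 - rho j q).
  elim: m => [|m IH]; first by rewrite !big_ord0 subrr.
  by rewrite !big_ord_recr /= IH /s; ring.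
have oT : open [set: V] by exact: openT.
exists s, pt; split.
- move=> n; apply: smooth_mul => //; apply: smooth_prod => // j.
  by apply: smooth_add => //; [exact: smooth_cst|exact: smooth_opp].
- move=> n q; apply: mulr_ge0; first by have /andP[] := rho01 n q.
  by apply: prodr_ge0 => j _; rewrite subr_ge0; have /andP[] := rho01 j q.
- move=> n q; rewrite /s /rho /okb /pt.
  case: (unpickle n) => [c|]; last by left; near=> x; rewrite mul0r.
  case: (asboolP (exists p, good c p)) => [ex|_]; last by left; near=> x; rewrite mul0r.
  have [Wp Bp] : good c (get (good c)) by case: ex => p gp; exact: (@getI _ (good c) p).
  have [Bq|] := pselect (box (ctr c) (2 * rad c) q); first by right; split=> //; exact: Bp.
  move=> /existsNP[i /negP]; rewrite -ltNge => /near_not_box Hi.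
  by left; apply: filterS Hi => x Hx; rewrite (bump_eq0 (rad0 c) Hx) mul0r.
- move=> q Wq; have [c [cq cN]] := rational_box (HN q Wq).
  have okc : okb (pickle c).
    by rewrite /okb pickleK; apply/asboolP; exists q.
  (* Bump number [pickle c] equals 1 around [q], so its factor [1 - rho] annihilates all later terms
     and the product left in [sumE]; the successor appears because that term itself still counts. *)
  exists (pickle c).+1; apply: filterS cq => x Hx.
  have r1 : rho (pickle c) x = 1 by rewrite /rho okc pickleK bump_eq1.
  have z m : (pickle c < m)%N -> \prod_(j < m) (1 - rho j x) = 0.
    by move=> cm; rewrite (bigD1 (Ordinal cm)) //= r1 subrr mul0r.
  split; first by rewrite sumE z // subr0.
  by move=> n cn; rewrite /s z // mulr0.
Unshelve. all: by end_near. Qed.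

End PartitionOfUnity.

(** * Smoothing a contraction *)

Section Averages.
Context {R : realType} {E : normedModType R}.

(** The locally finite sums below are cut at an index chosen point by point, with no regularity;
    this allows one fixed cut to be used near a given point. *)
Lemma sum_stable (F : nat -> E) (m1 m2 : nat) :
  (forall n, (m1 <= n)%N -> F n = 0) -> (forall n, (m2 <= n)%N -> F n = 0) ->
  \sum_(n < m1) F n = \sum_(n < m2) F n.
Proof.
wlog m12 : m1 m2 / (m1 <= m2)%N.
  move=> H h1 h2; case/orP: (leq_total m1 m2) => m12; first exact: H.
  by apply/esym; exact: H.
move=> h1 _; rewrite -!(big_mkord xpredT F) (@big_cat_nat _ _ _ m1 0 m2) //=.
have -> : \sum_(m1 <= n < m2) F n = 0; last by rewrite addr0.
by rewrite big_nat_cond big1 // => n /andP[/andP[m1n _] _]; exact: h1.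
Qed.

(** Convexity of the norm, in a form that names a term: the one farthest from [a] among those of
    nonzero weight. The nonzero weight makes the support condition of a partition of unity
    applicable to it. *)
Lemma average_near (m : nat) (s : nat -> R) (e : nat -> E) (a : E) :
  (forall n, 0 <= s n) -> \sum_(n < m) s n = 1 ->
  exists n, s n != 0 /\ `|\sum_(n < m) s n *: e n - a| <= `|e n - a|.
Proof.
move=> s0 s1.
have [i0 si0] : exists i : 'I_m, s i != 0.
  apply: contrapT => /forallNP Hn; have : (1 : R) = 0; last by move/eqP; rewrite oner_eq0.
  by rewrite -s1; apply: big1 => i _; apply/eqP/negPn/negP; exact: Hn.
have [i si imax] := @arg_maxP _ R _ i0 (fun i : 'I_m => s i != 0) (fun i => `|e i - a|) si0.
exists i; split=> //.
have -> : \sum_(n < m) s n *: e n - a = \sum_(n < m) s n *: (e n - a).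
  under [RHS]eq_bigr do rewrite scalerBr.
  by rewrite sumrB -scaler_suml s1 scale1r.
apply: le_trans (ler_norm_sum _ _ _) _.
rewrite -[leRHS]mul1r -s1 mulr_suml; apply: ler_sum => j _.
rewrite normrZ ger0_norm //.
have [->|sj] := eqVneq (s j) 0; first by rewrite !mul0r.
by rewrite ler_wpM2l //; exact: imax.
Qed.

End Averages.

Section SmoothContraction.
Context {R : realType} {E : normedModType R} (cs : coords E).

Let W (U : set E) : set (R * E) := [set p | U p.2].

Lemma cylinder_open (U : set E) : open U -> open (W U).
Proof. by move=> oU; apply: open_comp => // p _; exact: cvg_snd. Qed.

(** The time change always falls in [0, 1], so continuity relative to the cylinder over [0, 1]
    becomes ordinary continuity at all real times. *)
Lemma continuous_homotopy (U : set E) (H : R * E -> E) (p : R * E) : open U ->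
  {within `[0, 1] `*` U, continuous H} -> U p.2 ->
  {for p, continuous (fun q : R * E => H (clamp (3 * q.1 - 1), q.2))}.
Proof.
move=> oU /subspace_continuousP Hc Up.
pose g (q : R * E) := (clamp (3 * q.1 - 1), q.2).
have gA q : U q.2 -> (`[0, 1] `*` U) (g q).
  by move=> Uq; split=> //=; rewrite in_itv /=; exact: clamp_in.
have gc : {for p, continuous g}.
  apply: (@cvg_pair _ _ _ (nbhs p) (nbhs (g p).1) (nbhs (g p).2)).
    apply: (@continuous_comp _ _ _ (fun q : R * E => 3 * q.1 - 1) clamp).
      apply: cvgB; last exact: cvg_cst.
      by apply: cvgM; [exact: cvg_cst|exact: cvg_fst].
    exact: clamp_continuous.
  exact: cvg_snd.
move=> P HP; have := gc _ (Hc _ (gA p Up) P HP).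
have Un : \forall q \near p, U q.2.
  by apply: open_nbhs_nbhs; split=> //; exact: cylinder_open.
by apply: filterS2 Un => q /gA Aq; apply.
Qed.

(** Time ranges over all reals so that [K] is smooth around times 0 and 1, where the homotopy
    formula is evaluated. *)
Lemma smooth_contraction (U : set E) : open U -> contractible R U ->
  exists (c : E) (K : R * E -> E),
    [/\ U c, smooth_map cs [set p | U p.2] K,
        forall t z, U z -> U (K (t, z)) &
        forall z, U z -> K (0, z) = z /\ K (1, z) = c].
Proof.
move=> oU [c [H [Uc Hc HU H01]]].
(* [H'] is constant in time before 1/3 and after 2/3. *)
pose H' (q : R * E) := H (clamp (3 * q.1 - 1), q.2).
have H'U q : U q.2 -> U (H' q).
  by move=> Uq; apply: HU => //; rewrite in_itv /=; exact: clamp_in.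
have H'0 q : U q.2 -> q.1 <= 1 / 3 -> H' q = q.2.
  move=> Uq q1; rewrite /H' /clamp max_l; first by have [] := H01 _ Uq.
  by rewrite ge_min; apply/orP; right; lra.
have H'1 q : U q.2 -> 2 / 3 <= q.1 -> H' q = c.
  move=> Uq q1; rewrite /H' /clamp min_l; last by lra.
  by rewrite max_r //; have [] := H01 _ Uq.
(* Closeness is measured by a ball around [H' q] contained in [U]: an average of close points is no
   farther from [H' q] than the farthest of them, hence stays in [U]. *)
pose close e q := exists2 r : R, `|e - H' q| < r & ball_ Num.norm (H' q) r `<=` U.
have close_refl q : U q.2 -> close (H' q) q.
  move=> /H'U Uq; have /nbhs_normP[r r0 Hr] := open_nbhs_nbhs (conj oU Uq).
  by exists r => //; rewrite subrr normr0.
(* The middle neighbourhoods avoid times 0 and 1. There only the identity or the constant [c]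
   contributes, and the average keeps both end conditions exactly. *)
pose N (p : R * E) : set (R * E) := if p.1 < 1 / 3 then [set q | q.1 < 1 / 3]
  else if 2 / 3 < p.1 then [set q | 2 / 3 < q.1]
  else [set q | 0 < q.1 < 1 /\ close (H' p) q].
pose h (p q : R * E) : E := if p.1 < 1 / 3 then q.2 else if 2 / 3 < p.1 then c else H' p.
have Nn p : W U p -> nbhs p (N p).
  move=> Up; rewrite /N; case: ltP => p1.
    exact: (cvgr_lt _ (@cvg_fst _ _ (nbhs p.1) (nbhs p.2) _) _ p1).
  case: ltP => p2.
    exact: (cvgr_gt _ (@cvg_fst _ _ (nbhs p.1) (nbhs p.2) _) _ p2).
  have /nbhs_normP[r r0 Hr] := open_nbhs_nbhs (conj oU (H'U p Up)).
  have r2 : 0 < r / 2 by rewrite divr_gt0.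
  have n1 : \forall q \near p, 0 < q.1.
    by apply: (cvgr_gt _ (@cvg_fst _ _ (nbhs p.1) (nbhs p.2) _)); lra.
  have n2 : \forall q \near p, q.1 < 1.
    by apply: (cvgr_lt _ (@cvg_fst _ _ (nbhs p.1) (nbhs p.2) _)); lra.
  have /cvgrPdist_lt/(_ _ r2) n3 := continuous_homotopy oU Hc Up.
  apply: filterS3 n1 n2 n3 => q q1 q2 q3; split; first by rewrite q1.
  exists (r / 2) => // x Hx; apply: Hr; rewrite /ball_ /= (splitr r).
  by apply: le_lt_trans (ler_distD (H' q) _ _) _; apply: ltrD.
have Hh p q : W U p -> W U q -> N p q ->
    [/\ close (h p q) q, q.1 <= 0 -> h p q = q.2 & 1 <= q.1 -> h p q = c].
  move=> Up Uq; rewrite /N /h; case: ltP => p1 /=.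
    move=> q1; split=> // [|q2]; last by exfalso; lra.
    by have := close_refl q Uq; rewrite (H'0 q Uq (ltW q1)).
  case: ltP => p2 /=.
    move=> q1; split=> // [|q2]; last by exfalso; lra.
    by have := close_refl q Uq; rewrite (H'1 q Uq (ltW q1)).
  by move=> [/andP[q0 q1] cl]; split=> // q2; exfalso; lra.
have [s [pt [ss s0 sN sfin]]] :=
  @partition_of_unity _ _ (coords_prod coords_real cs) (W U) N Nn.
have /choice[m Hm] (q : R * E) : exists m, W U q -> \forall x \near q,
    \sum_(n < m) s n x = 1 /\ forall n, (m <= n)%N -> s n x = 0.
  by have [/sfin[m Hm]|nW] := pselect (W U q); [exists m|exists 0%N].
pose K q := \sum_(n < m q) s n q *: h (pt n) q.
have oW := cylinder_open oU.
have Kloc q : W U q -> \forall x \near q, K x = \sum_(n < m q) s n x *: h (pt n) x.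
  move=> Wq; have Wn : \forall x \near q, W U x by exact: open_nbhs_nbhs (conj oW Wq).
  apply: filterS2 Wn (Hm q Wq) => x Wx [_ sx].
  apply: (@sum_stable _ _ (fun n => s n x *: h (pt n) x)) => n mn; last by rewrite sx // scale0r.
  by have [_ ->] := nbhs_singleton (Hm x Wx); rewrite ?scale0r.
(* Taken with [a = H' q] this keeps [K q] in [U]; with [a] equal to [z] or [c] at the end times the
   right-hand side is 0 and forces equality. *)
have Kavg q a : W U q -> exists p, [/\ W U p, N p q & `|K q - a| <= `|h p q - a|].
  move=> Wq; have [s1 _] := nbhs_singleton (Hm q Wq).
  have [n [sn Hn]] := average_near (fun n => h (pt n) q) a (fun n => s0 n q) s1.
  have [/nbhs_singleton sn0|[Wp Np]] := sN n q; first by rewrite sn0 eqxx in sn.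
  by exists (pt n); split.
exists c, K; split=> //.
- move=> i; apply: smooth_local => q Wq.
  have [r r0 Hr] := (nbhs_normP _ _).1 (filterI (open_nbhs_nbhs (conj oW Wq)) (Kloc q Wq)).
  exists (ball_ Num.norm q r); split; first by rewrite /ball_ /= subrr normr0.
  have ob : open (ball_ Num.norm q r) by rewrite ball_normE; exact: ball_open.
  apply: (@smooth_ext _ _ _ (fun x => \sum_(n < m q) s n x * ccrd i (h (pt n) x))) => //.
    move=> x /Hr[_ Kx]; rewrite /= Kx linear_sum; apply: eq_bigr => n _.
    by rewrite linearZ.
  apply: smooth_sum => // n _; apply: smooth_mul => //.
    exact: smooth_sub (ss n).
  rewrite /h; case: ((pt n).1 < 1 / 3); last by case: (2 / 3 < (pt n).1); exact: smooth_cst.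
  exact: (@smooth_ccrd _ _ (coords_prod coords_real cs) _ (inr i)).
- move=> t z Uz; have Wq : W U (t, z) by [].
  have [p [Wp Np Hp]] := Kavg (t, z) (H' (t, z)) Wq.
  have [[r hr Hr] _ _] := Hh p _ Wp Wq Np.
  by apply: Hr; rewrite /ball_ /= distrC; exact: le_lt_trans Hp hr.
- move=> z Uz; split.
    have Wq : W U (0, z) by [].
    have [p [Wp Np Hp]] := Kavg (0, z) z Wq.
    have [_ h0 _] := Hh p _ Wp Wq Np.
    move: Hp; rewrite h0 //= subrr normr0 normr_le0 subr_eq0.
    by move/eqP.
  have Wq : W U (1, z) by [].
  have [p [Wp Np Hp]] := Kavg (1, z) c Wq.
  have [_ _ h1] := Hh p _ Wp Wq Np.
  move: Hp; rewrite h1 //= subrr normr0 normr_le0 subr_eq0.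
  by move/eqP.
Qed.

End SmoothContraction.

(** * The homotopy operator on 1-forms and 2-forms *)

Section VectorDerivative.
Context {R : realType} {V E : normedModType R} (cs : coords E).
Implicit Types (K P : V -> E) (O : set V) (q x u v : V).

Lemma lin_expand (g : E -> R) (v : E) : linear g ->
  g v = \sum_i ccrd (c := cs) i v * g (cvec i).
Proof.
move=> Lg; pose L : {linear E -> R} := HB.pack g (GRing.isLinear.Build _ _ _ _ _ Lg).
rewrite -[g]/(L : E -> R) {1}[v](ccrdE cs) linear_sum; apply: eq_bigr => i _.
by rewrite linearZ.
Qed.

Lemma coords_inj (u v : E) : (forall i, ccrd (c := cs) i u = ccrd i v) -> u = v.
Proof. by move=> H; rewrite (ccrdE cs u) (ccrdE cs v); under eq_bigr do rewrite H. Qed.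

Lemma is_derive_linear (L : {linear E -> R}) K q x (K' : E) : continuous L ->
  is_derive q x K K' -> is_derive q x (L \o K) (L K').
Proof.
move=> Lc [dK <-].
have dl : differentiable (fun h : R => K (h *: x + q)) (0 : R).
  by apply/derivable1_diffP; have /derivable1P := dK.
have dL : differentiable L (K (0 *: x + q)) by exact: linear_differentiable.
have dc : differentiable (L \o (fun h : R => K (h *: x + q))) (0 : R).
  exact: differentiable_comp.
apply: DeriveDef; first by apply/derivable1P/derivable1_diffP.
rewrite derive_lineE.
have -> : (fun h : R => (L \o K) (h *: x + q)) = L \o (fun h : R => K (h *: x + q)) by [].
rewrite deriveE // diff_comp // [in RHS]derive_lineE.
by rewrite [in RHS]deriveE //= diff_lin.
Qed.

Lemma is_derive_coords K q x : (forall i, derivable (ccrd (c := cs) i \o K) q x) ->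
  is_derive q x K ('D_x K q) /\
  forall i, ccrd (c := cs) i ('D_x K q) = 'D_x (ccrd i \o K) q.
Proof.
move=> dK.
have dl : is_derive (0 : R) (1 : R) (fun h : R => K (h *: x + q))
    (\sum_i 'D_x (ccrd (c := cs) i \o K) q *: cvec i).
  have -> : (fun h : R => K (h *: x + q)) =
      fun h => \sum_i ccrd i (K (h *: x + q)) *: cvec (c := cs) i.
    by apply/funext => s; exact: ccrdE.
  apply: is_derive_bigsum => i; apply: is_derive1_scalel.
  apply: DeriveDef; first by have /derivable1P := dK i.
  by rewrite [RHS]derive_lineE.
have [d1 d2] := dl.
have D : is_derive q x K ('D_x K q).
  by apply: DeriveDef => //; apply/derivable1P.
split=> // i.
by have [_ ->] := is_derive_linear (@ccrd_cont _ _ cs i) D.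
Qed.

Lemma smooth_map_derivable O K q x : smooth_map cs O K -> O q ->
  is_derive q x K ('D_x K q).
Proof.
by move=> HK Oq; have [] := @is_derive_coords K q x (fun i => smooth_derivable (v := x) (HK i) Oq).
Qed.

Lemma smooth_map_ccrd O K q x i : smooth_map cs O K -> O q ->
  ccrd (c := cs) i ('D_x K q) = 'D_x (ccrd i \o K) q.
Proof.
by move=> HK Oq; have [_ ->] := @is_derive_coords K q x (fun i => smooth_derivable (v := x) (HK i) Oq).
Qed.

Lemma smooth_map_derive O K x : open O -> smooth_map cs O K ->
  smooth_map cs O (fun q => 'D_x K q).
Proof.
move=> oO HK i; apply: (@smooth_ext _ _ _ (fun q => 'D_x (ccrd i \o K) q)) => //.
  by move=> q Oq; rewrite /= (smooth_map_ccrd _ _ HK).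
exact: smooth_derive.
Qed.

Lemma schwarz_map O K q u v : open O -> smooth_map cs O K -> O q ->
  'D_u (fun x => 'D_v K x) q = 'D_v (fun x => 'D_u K x) q.
Proof.
move=> oO HK Oq; apply: coords_inj => i.
have E1 (a b : V) : ccrd (c := cs) i ('D_a (fun x => 'D_b K x) q) =
    'D_a (fun x => 'D_b (ccrd i \o K) x) q.
  rewrite (smooth_map_ccrd _ _ (smooth_map_derive b oO HK) Oq).
  apply: near_eq_derive; apply: (eq_near_in oO Oq) => x Ox.
  by rewrite /= (smooth_map_ccrd _ _ HK).
by rewrite !E1; exact: (schwarz u v oO (HK i 2%N) Oq).
Qed.

(** Product rule for a form evaluated on a moving vector; expanding the vector in coordinates
    reduces it to products of scalar functions. *)
Lemma is_derive_lin (f : V -> E -> R) (f' : E -> R) P q x (P' : E) :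
  (forall z, linear (f z)) -> (forall y, is_derive q x (f^~ y) (f' y)) ->
  is_derive q x P P' -> is_derive q x (fun z => f z (P z)) (f' (P q) + f q P').
Proof.
move=> Lf df dP.
have -> : (fun z => f z (P z)) = fun z => \sum_i ccrd (c := cs) i (P z) * f z (cvec i).
  by apply/funext => z; exact: lin_expand.
have f'E w : f' w = \sum_i ccrd (c := cs) i w * f' (cvec i).
  have [_ <-] := df w.
  have -> : f^~ w = fun z => \sum_i ccrd (c := cs) i w * f z (cvec i).
    by apply/funext => z; exact: lin_expand.
  have := is_derive_bigsum (index_enum (cdim cs))
    (fun i => is_deriveZ (ccrd (c := cs) i w) (df (cvec i))).
  by case.
rewrite f'E (lin_expand P' (Lf q)) -big_split /=.
apply: is_derive_bigsum => i.
have := is_deriveM (is_derive_linear (@ccrd_cont _ _ cs i) dP) (df (cvec i)).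
by rewrite /GRing.scale /= [X in _ + X]mulrC.
Qed.

Lemma smooth_lin O (f : V -> E -> R) P : open O -> (forall z, linear (f z)) ->
  (forall y, smooth_on O (f^~ y)) -> smooth_map cs O P ->
  smooth_on O (fun z => f z (P z)).
Proof.
move=> oO Lf sf sP.
apply: (@smooth_ext _ _ _ (fun z => \sum_i ccrd (c := cs) i (P z) * f z (cvec i))) => //.
  by move=> z _; rewrite -lin_expand.
by apply: smooth_sum => // i _; apply: smooth_mul => //; exact: sP.
Qed.

Lemma is_derive_compD (U : set E) (f : E -> R) O K q x : open U -> smooth_on U f ->
  smooth_map cs O K -> O q -> U (K q) ->
  is_derive q x (f \o K) ('D_('D_x K q) f (K q)).
Proof.
move=> oU sf sK Oq UK.
rewrite (C1_deriveE cs _ oU (sf 1%N) UK).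
under eq_bigr do rewrite (smooth_map_ccrd _ _ sK Oq).
apply: is_derive_comp => [|i]; last exact: smooth_derivable (sK i) Oq.
exact: C1_differentiable cs _ _ _ oU (sf 1%N) UK.
Qed.

End VectorDerivative.

Section HomotopyOperator.
Context {R : realType} {E : normedModType R} (cs : coords E).
Variables (U : set E) (c : E) (K : R * E -> E).
Hypothesis oU : open U.
Hypothesis sK : smooth_map cs [set p | U p.2] K.
Hypothesis KU : forall t z, U z -> U (K (t, z)).
Hypothesis K01 : forall z, U z -> K (0, z) = z /\ K (1, z) = c.

Let O : set (R * E) := [set p | U p.2].
Let oO : open O := cylinder_open oU.
Let csO := coords_prod coords_real cs.
Let tau : R * E := (1, 0).

Let KO q : O q -> U (K q).
Proof. by case: q => t z; exact: KU. Qed.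

Let tubeO z : U z -> tube O z.
Proof. by move=> Uz t _. Qed.

Lemma homotopy_start z v : U z -> 'D_((0, v) : R * E) K (0, z) = v.
Proof.
move=> Uz; apply: (coords_inj (cs := cs)) => i.
rewrite (smooth_map_ccrd _ _ sK) //=.
have [_ <-] := is_derive_ccrd i z v.
rewrite derive_lineE [RHS]derive_lineE; apply: near_eq_derive.
have Un : \forall h \near (0 : R), U (h *: v + z).
  have c0 : {for 0, continuous (fun h : R => h *: v + z)}.
    by apply: cvgD; [apply: cvgZr_tmp; exact: cvg_id|exact: cvg_cst].
  by apply: c0; rewrite scale0r add0r; exact: open_nbhs_nbhs.
apply: filterS Un => h Uh /=.
have -> : h *: ((0, v) : R * E) + (0, z) = (0, h *: v + z).
  by congr pair; rewrite /= scaler0 addr0.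
by have [-> _] := K01 Uh.
Qed.

Lemma homotopy_end z v : U z -> 'D_((0, v) : R * E) K (1, z) = 0.
Proof.
move=> Uz; rewrite derive_lineE.
have -> : 0 = 'D_(1 : R) (cst c) (0 : R) :> E by rewrite derive_cst.
apply: near_eq_derive.
have Un : \forall h \near (0 : R), U (h *: v + z).
  have c0 : {for 0, continuous (fun h : R => h *: v + z)}.
    by apply: cvgD; [apply: cvgZr_tmp; exact: cvg_id|exact: cvg_cst].
  by apply: c0; rewrite scale0r add0r; exact: open_nbhs_nbhs.
apply: filterS Un => h Uh /=.
have -> : h *: ((0, v) : R * E) + (1, z) = (1, h *: v + z).
  by congr pair; rewrite /= scaler0 add0r.
by have [_ ->] := K01 Uh.
Qed.

Lemma int01_derive (G : R * E -> R) z : smooth_on O G -> U z ->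
  int01 (fun t => 'D_tau G (t, z)) = G (1, z) - G (0, z).
Proof.
move=> sG Uz; apply: (@int01E _ _ (fun t => G (t, z))) => t t01.
have E1 (s : R) : ((0, z) : R * E) + s *: tau = (s, z).
  by congr pair; rewrite /= ?scaler0 ?addr0 // add0r [s *: 1]mulr1.
have := @is_derive_line R (R * E)%type G (0, z) tau t.
have Oq : O (t, z) by [].
rewrite E1 => /(_ (smooth_derivable (v := tau) sG Oq)).
suff -> : (fun s : R => G ((0, z) + s *: tau)) = fun s => G (s, z) by [].
by apply/funext => s; rewrite E1.
Qed.

Section OneForm.
Variable b : E -> E -> R.
Hypothesis Lb : forall z, linear (b z).
Hypothesis sb : forall v, smooth_on U (b^~ v).

Let bK (u : R * E) (q : R * E) : R := b (K q) ('D_u K q).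

Lemma smooth_pullback1 u : smooth_on O (bK u).
Proof.
apply: (@smooth_lin _ _ _ cs O (fun q v => b (K q) v)) => //.
  by move=> v; apply: (@smooth_comp _ _ _ cs O U (b^~ v) K).
exact: smooth_map_derive.
Qed.

Lemma is_derive_pullback1 u x q : O q -> is_derive q x (bK u)
  ('D_('D_x K q) (b^~ ('D_u K q)) (K q) + b (K q) ('D_x (fun p => 'D_u K p) q)).
Proof.
move=> Oq.
apply: (@is_derive_lin _ _ _ cs (fun q v => b (K q) v)
  (fun v => 'D_('D_x K q) (b^~ v) (K q)) (fun p => 'D_u K p)) => //.
  move=> v; apply: (@is_derive_compD _ _ _ cs U (b^~ v) O K) => //.
  exact: KO.
exact: smooth_map_derivable (smooth_map_derive u oO sK) Oq.
Qed.

(** Homotopy operator on 1-forms: the time component of the pullback of [b] by [K], integrated over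
    time. The sign comes from [K] being the identity at time 0 and constant at time 1. *)
Definition primitive1 (z : E) : R := - int01 (fun t => bK tau (t, z)).

(** Closedness of [b] and symmetry of the second derivatives of [K] exchange the directions [(0, v)]
    and [tau] under the integral, leaving a total time derivative. Its end value at time 1 vanishes
    because [K] is constant there. *)
Lemma is_derive_primitive1 z v : U z ->
  (forall x y a, U x -> 'D_y (b^~ a) x = 'D_a (b^~ y) x) ->
  is_derive z v primitive1 (b z v).
Proof.
move=> Uz cl; have s1 := smooth_pullback1 tau.
have := @int01_param_derive _ _ _ oO _ z v (s1 1%N) (tubeO Uz).
move/is_deriveN.
have -> : int01 (fun t => 'D_((0, v) : R * E) (bK tau) (t, z)) =
    int01 (fun t => 'D_tau (bK (0, v)) (t, z)).
  congr int01; apply/funext => t; have Oq : O (t, z) by [].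
  have [_ ->] := is_derive_pullback1 tau (0, v) Oq.
  have [_ ->] := is_derive_pullback1 (0, v) tau Oq.
  by rewrite cl; [rewrite (schwarz_map _ _ oO sK Oq)|exact: KO].
rewrite int01_derive //; last exact: smooth_pullback1.
rewrite /bK homotopy_start // homotopy_end // (K01 Uz).1.
have -> : b (K (1, z)) 0 = 0.
  by rewrite (lin_expand cs 0 (Lb _)) big1 // => i _; rewrite linear0 mul0r.
by rewrite sub0r opprK.
Qed.

End OneForm.

Section TwoForm.
Variable w : E -> E -> E -> R.
Hypothesis Lw1 : forall z v, linear (fun u => w z u v).
Hypothesis Lw2 : forall z u, linear (w z u).
Hypothesis sw : forall u v, smooth_on U (fun z => w z u v).
Hypothesis aw : forall z u v, w z u v = - w z v u.
Hypothesis dw : forall z x u v, U z -> 'D_x (fun z => w z u v) z -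
  'D_u (fun z => w z x v) z + 'D_v (fun z => w z x u) z = 0.

Let wK (u v : R * E) (q : R * E) : R := w (K q) ('D_u K q) ('D_v K q).

Lemma smooth_pullback2 u v : smooth_on O (wK u v).
Proof.
apply: (@smooth_lin _ _ _ cs O (fun q y => w (K q) ('D_u K q) y)) => //; last first.
  exact: smooth_map_derive.
move=> y; apply: (@smooth_lin _ _ _ cs O (fun q a => w (K q) a y)) => //.
  by move=> a; apply: (@smooth_comp _ _ _ cs O U (fun z => w z a y) K).
exact: smooth_map_derive.
Qed.

Lemma is_derive_pullback2 u v x q : O q -> is_derive q x (wK u v)
  ('D_('D_x K q) (fun z => w z ('D_u K q) ('D_v K q)) (K q) +
   w (K q) ('D_x (fun p => 'D_u K p) q) ('D_v K q) +
   w (K q) ('D_u K q) ('D_x (fun p => 'D_v K p) q)).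
Proof.
move=> Oq.
apply: (@is_derive_lin _ _ _ cs (fun q y => w (K q) ('D_u K q) y)
  (fun y => 'D_('D_x K q) (fun z => w z ('D_u K q) y) (K q) +
     w (K q) ('D_x (fun p => 'D_u K p) q) y) (fun p => 'D_v K p)) => //.
  move=> y; apply: (@is_derive_lin _ _ _ cs (fun q a => w (K q) a y)
    (fun a => 'D_('D_x K q) (fun z => w z a y) (K q)) (fun p => 'D_u K p)) => //.
    move=> a; apply: (@is_derive_compD _ _ _ cs U (fun z => w z a y) O K) => //.
    exact: KO.
  exact: smooth_map_derivable (smooth_map_derive u oO sK) Oq.
exact: smooth_map_derivable (smooth_map_derive v oO sK) Oq.
Qed.

(** Exterior differentiation commutes with pullback: besides [dw] at [K q], the product rule
    produces six terms with second derivatives of [K], which cancel in pairs by Schwarz and skew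
    symmetry. *)
Lemma closed_pullback2 x u v q : O q ->
  'D_x (wK u v) q - 'D_u (wK x v) q + 'D_v (wK x u) q = 0.
Proof.
move=> Oq.
have [_ ->] := is_derive_pullback2 u v x Oq.
have [_ ->] := is_derive_pullback2 x v u Oq.
have [_ ->] := is_derive_pullback2 x u v Oq.
have := dw ('D_x K q) ('D_u K q) ('D_v K q) (KO Oq).
rewrite (schwarz_map u x oO sK Oq) (schwarz_map v x oO sK Oq)
  (schwarz_map v u oO sK Oq).
rewrite (aw (K q) ('D_x K q) ('D_u (fun p => 'D_v K p) q)).
rewrite (aw (K q) ('D_u K q) ('D_x (fun p => 'D_v K p) q)).
move: ('D_('D_x K q) _ _) ('D_('D_u K q) _ _) ('D_('D_v K q) _ _) => a1 a2 a3 H.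
by lra.
Qed.

(** Homotopy operator on 2-forms: the pulled back form contracted with the time direction and
    integrated, with the sign of [primitive1]. *)
Definition primitive2 (z : E) (v : E) : R := - int01 (fun t => wK tau (0, v) (t, z)).

Lemma smooth_primitive2 v : smooth_on U (primitive2^~ v).
Proof.
apply: smooth_opp => //; have := @smooth_int01 _ _ _ oO _ (smooth_pullback2 tau (0, v)).
exact: smooth_sub.
Qed.

Lemma linear_primitive2 z : U z -> linear (primitive2 z).
Proof.
move=> Uz a u v; rewrite /primitive2.
have c1 y t : 0 <= t <= 1 -> {for t, continuous (fun s => wK tau (0, y) (s, z))}.
  by move=> t01; exact: (slice_cont (tubeO Uz) t01 (smooth_pullback2 tau (0, y) 0%N)).
have -> : (fun t => wK tau (0, a *: u + v) (t, z)) =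
    fun t => a * wK tau (0, u) (t, z) + wK tau (0, v) (t, z).
  apply/funext => t; rewrite /wK -[a * _]/(a *: _) -Lw2; congr (w _ _ _).
  have Oq : O (t, z) by [].
  apply: (coords_inj (cs := cs)) => i; rewrite linearP !(smooth_map_ccrd _ _ sK Oq).
  rewrite -(C1_deriveD csO _ _ _ oO (sK i 1%N) Oq).
  by congr ('D_ _ _ _); congr pair; rewrite /= scaler0 addr0.
by rewrite int01_lin //; [rewrite opprD -mulrN|exact: c1|exact: c1].
Qed.

(** Closedness of the pullback on [tau], [(0, u)], [(0, v)] makes the skew difference of the
    integrands the time derivative of [wK (0, u) (0, v)], whose end values are [w z u v] at time 0
    and 0 at time 1. *)
Lemma ext_primitive2 z u v : U z ->
  'D_u (primitive2^~ v) z - 'D_v (primitive2^~ u) z = w z u v.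
Proof.
move=> Uz.
have D x y : is_derive z x (primitive2^~ y)
    (- int01 (fun t => 'D_((0, x) : R * E) (wK tau (0, y)) (t, z))).
  have := @int01_param_derive _ _ _ oO _ z x (smooth_pullback2 tau (0, y) 1%N) (tubeO Uz).
  by move/is_deriveN.
have [_ ->] := D u v; have [_ ->] := D v u.
have c1 x y t : 0 <= t <= 1 ->
    {for t, continuous (fun s => 'D_((0, x) : R * E) (wK tau (0, y)) (s, z))}.
  move=> t01; pose g p := 'D_((0, x) : R * E) (wK tau (0, y)) p.
  apply: (@slice_cont _ _ O g z t (tubeO Uz) t01).
  exact: smooth_derive (smooth_pullback2 tau (0, y)) 0%N.
rewrite -opprD int01_sub; [|exact: c1|exact: c1].
rewrite (_ : (fun t => _ - _) = fun t => 'D_tau (wK (0, u) (0, v)) (t, z)); last first.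
  apply/funext => t; have Oq : O (t, z) by [].
  have lin3 (a1 a2 a3 : R) : a1 - a2 + a3 = 0 -> a2 - a3 = a1 by move=> ?; lra.
  exact: lin3 (closed_pullback2 tau (0, u) (0, v) Oq).
rewrite int01_derive //; last exact: smooth_pullback2.
rewrite /wK !homotopy_start // !homotopy_end // (K01 Uz).1.
have -> : w (K (1, z)) 0 0 = 0.
  by rewrite (lin_expand cs 0 (Lw2 _ _)) big1 // => i _; rewrite linear0 mul0r.
by rewrite sub0r opprK.
Qed.

End TwoForm.
End HomotopyOperator.

(** * Primitives along the fibres *)

Section Slices.
Context {R : realType} {E1 E2 W : normedModType R}.

Lemma derive_slicel (f : E1 * E2 -> W) (x u : E1) (y : E2) :
  'D_u (fun a => f (a, y)) x = 'D_((u, 0) : E1 * E2) f (x, y).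
Proof.
rewrite derive_lineE [RHS]derive_lineE.
have -> : (fun h : R => f (h *: ((u, 0) : E1 * E2) + (x, y))) =
    fun h => f (h *: u + x, y); last by [].
by apply/funext => h; congr f; congr pair; rewrite /= scaler0 add0r.
Qed.

Lemma derive_slicer (f : E1 * E2 -> W) (x : E1) (y v : E2) :
  'D_v (fun a => f (x, a)) y = 'D_((0, v) : E1 * E2) f (x, y).
Proof.
rewrite derive_lineE [RHS]derive_lineE.
have -> : (fun h : R => f (h *: ((0, v) : E1 * E2) + (x, y))) =
    fun h => f (x, h *: v + y); last by [].
by apply/funext => h; congr f; congr pair; rewrite /= scaler0 add0r.
Qed.

Lemma is_derive_slicer (f : E1 * E2 -> W) (x : E1) (y v : E2) (d : W) :
  is_derive y v (fun a => f (x, a)) d -> is_derive (x, y) ((0, v) : E1 * E2) f d.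
Proof.
move=> [d1 <-]; rewrite derive_slicer; apply: DeriveDef => //.
apply/derivable1P; have /derivable1P := d1.
have -> : (fun h : R => f (h *: ((0, v) : E1 * E2) + (x, y))) =
  (fun h => f (x, h *: v + y)); last by [].
by apply/funext => h; congr f; congr pair; rewrite /= scaler0 add0r.
Qed.

End Slices.

Lemma smooth_germ {R : realType} {V : normedModType R} (U : set V) (f : V -> R) :
  (forall z, U z -> exists O g, [/\ open O, O z, smooth_on O g & \forall x \near z, g x = f x]) ->
  smooth_on U f.
Proof.
move=> H; apply: smooth_local => z /H[ O [g [oO Oz sg gf]]].
have [r r0 Hr] := (nbhs_normP _ _).1 (filterI (open_nbhs_nbhs (conj oO Oz)) gf).
exists (ball_ Num.norm z r); split; first by rewrite /ball_ /= subrr normr0.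
apply: (@smooth_ext _ _ _ g).
- by rewrite ball_normE; exact: ball_open.
- by move=> x /Hr[].
- by apply: smooth_sub sg => x /Hr[].
Qed.

Section FibrewisePrimitive.
Context {R : realType} {E1 E2 : normedModType R} (c1 : coords E1) (c2 : coords E2).
Variables (U : set (E1 * E2)) (B : E1 * E2 -> E2 -> R).
Hypothesis oU : open U.
Hypothesis Ufib : forall x, [set y | U (x, y)] !=set0 -> contractible R [set y | U (x, y)].
Hypothesis LB : forall z, linear (B z).
Hypothesis sB : forall v, smooth_on U (B^~ v).
Hypothesis cB : forall z u v, U z ->
  'D_((0, u) : E1 * E2) (B^~ v) z = 'D_((0, v) : E1 * E2) (B^~ u) z.

Let cs := coords_prod c1 c2.
Let Ux (x : E1) : set E2 := [set y | U (x, y)].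

Lemma pair_continuous (x : E1) : continuous (fun y : E2 => (x, y)).
Proof.
by move=> y; apply: (@cvg_pair _ _ _ (nbhs y) (nbhs x) (nbhs y)); [exact: cvg_cst|exact: cvg_id].
Qed.

Lemma pairl_continuous (y : E2) : continuous (fun x : E1 => (x, y)).
Proof.
by move=> x; apply: (@cvg_pair _ _ _ (nbhs x) (nbhs x) (nbhs y)); [exact: cvg_id|exact: cvg_cst].
Qed.

Lemma fibre_open x : open (Ux x).
Proof. by apply: (@open_comp _ _ (fun y : E2 => (x, y))) => // y _; exact: pair_continuous. Qed.

Lemma smooth_pair x A : smooth_map cs A (fun y : E2 => (x, y)).
Proof. by case=> i; [exact: (@smooth_cst _ _ A (ccrd i x))|exact: (@smooth_ccrd _ _ c2 A i)]. Qed.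

(** Built from a contraction of this fibre alone, hence smooth along the fibre but with no
    information on how it varies with [x]. *)
Lemma fibre_primitive x : exists f : E2 -> R,
  smooth_on (Ux x) f /\ forall y v, U (x, y) -> is_derive y v f (B (x, y) v).
Proof.
have oUx := fibre_open x.
have [ne|nUx] := pselect (Ux x !=set0); last first.
  by exists (fun=> 0); split=> [|y v Uy]; [exact: smooth_cst|case: nUx; exists y].
have [c [K [Uc sK KU K01]]] := smooth_contraction c2 oUx (Ufib ne).
pose b (y : E2) v := B (x, y) v.
have Lb y : linear (b y) by exact: LB.
have sb v : smooth_on (Ux x) (b^~ v).
  by apply: (@smooth_comp _ _ _ cs _ U (B^~ v)) => //; exact: smooth_pair.
have clb y u v : Ux x y -> 'D_u (b^~ v) y = 'D_v (b^~ u) y.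
  by move=> Uy; rewrite (derive_slicer (B^~ v)) (derive_slicer (B^~ u)) cB.
exists (primitive1 K b); split; last first.
  by move=> y v Uy; apply: (is_derive_primitive1 oUx sK KU K01 Lb sb _ Uy) => *; exact: clb.
apply: smooth_opp => //.
have := @smooth_int01 _ _ _ (cylinder_open oUx) _ (smooth_pullback1 oUx sK KU Lb sb (1, 0)).
by apply: smooth_sub => y Uy t _; exact: Uy.
Qed.

Section Local.
Variables (phi : E1 -> E2 -> R) (x1 : E1).
Hypothesis sphi : forall x, smooth_on (Ux x) (phi x).
Hypothesis dphi : forall x y v, U (x, y) -> is_derive y v (phi x) (B (x, y) v).

(* The integral along the contraction of the single fibre over [x1] still computes
   [phi x c - phi x y] for [x] near [x1], and depends smoothly on [x]. *)
Lemma local_primitive : Ux x1 !=set0 ->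
  exists (V : set (E1 * E2)) (psi : E1 * E2 -> R) (c : E2),
    [/\ open V, forall y, U (x1, y) -> V (x1, y), smooth_on V psi &
        forall x y, V (x, y) -> psi (x, y) = phi x c - phi x y].
Proof.
move=> ne; have oUx := fibre_open x1.
have [c [K [Uc sK KU K01]]] := smooth_contraction c2 oUx (Ufib ne).
pose ty (q : R * (E1 * E2)) : R * E2 := (q.1, q.2.2).
(* [K] contracts the fibre over [x1], but its path is followed over the base point of [q];
   membership in [O] says in particular that the moved point still lies in [U]. *)
pose M (q : R * (E1 * E2)) : E1 * E2 := (q.2.1, K (ty q)).
pose O : set (R * (E1 * E2)) := [set q | U (x1, q.2.2) /\ U (M q)].
have tyc : continuous ty.
  move=> q; apply: (@cvg_pair _ _ _ (nbhs q) (nbhs q.1) (nbhs q.2.2)); first exact: cvg_fst.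
  by apply: (@cvg_comp _ _ _ snd snd _ (nbhs q.2)); exact: cvg_snd.
have oA : open [set q : R * (E1 * E2) | U (x1, q.2.2)].
  by apply: (@open_comp _ _ ty [set p : R * E2 | U (x1, p.2)]) => [q _|]; [exact: tyc|exact: (cylinder_open oUx)].
have Mc q : U (x1, q.2.2) -> {for q, continuous M}.
  move=> Uq; apply: (@cvg_pair _ _ _ (nbhs q) (nbhs q.2.1) (nbhs (K (ty q)))).
    by apply: (@cvg_comp _ _ _ snd fst _ (nbhs q.2)); [exact: cvg_snd|exact: cvg_fst].
  apply: (@continuous_comp _ _ _ ty K); first exact: tyc.
  exact: (@smooth_map_cont _ _ _ c2 [set p | U (x1, p.2)] K (ty q) sK Uq).
have oO : open O.
  rewrite openE => q [Uq UM]; apply: filterI.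
    exact: (open_nbhs_nbhs (conj oA Uq)).
  exact: (Mc q Uq _ (open_nbhs_nbhs (conj oU UM))).
have sty (A : set (R * (E1 * E2))) : smooth_map (coords_prod coords_real c2) A ty.
  case=> i.
    exact: (@smooth_ccrd _ _ (coords_prod coords_real cs) A (inl i)).
  exact: (@smooth_ccrd _ _ (coords_prod coords_real cs) A (inr (inr i))).
have comp_ty (f : R * E2 -> R) : smooth_on [set p | U (x1, p.2)] f -> smooth_on O (f \o ty).
  move=> sf; apply: (smooth_comp (cs := coords_prod coords_real c2) oO _ _ (sty O) sf).
    exact: cylinder_open oUx.
  by move=> q [].
have sM : smooth_map cs O M.
  case=> i.
    exact: (@smooth_ccrd _ _ (coords_prod coords_real cs) O (inr (inl i))).
  exact: comp_ty (sK i).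
pose g q := B (M q) ('D_((1, 0) : R * E2) K (ty q)).
have sg : smooth_on O g.
  apply: (@smooth_lin _ _ _ c2 O (fun q v => B (M q) v) (fun q => 'D_((1, 0) : R * E2) K (ty q))) => //.
    move=> v; apply: (@smooth_comp _ _ _ cs O U (B^~ v) M) => //.
    by move=> q [].
  move=> i; apply: (comp_ty (fun p => ccrd i ('D_((1, 0) : R * E2) K p))).
  exact: (@smooth_map_derive _ _ _ c2 _ K (1, 0) (cylinder_open oUx) sK i).
exists (tube O), (fun z => int01 (fun t => g (t, z))), c; split.
- exact: tube_open.
- by move=> y Uy t _; split=> //; exact: KU.
- exact: smooth_int01.
- move=> x y Vxy.
  have Uy : U (x1, y) by have [|] := Vxy 0 _; rewrite ?lexx ?ler01.
  have -> : phi x c - phi x y = phi x (K (1, y)) - phi x (K (0, y)).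
    by have [-> ->] := K01 y Uy.
  (* The derivative of [phi x] along the path is given by [B], so the integrand [g] involves no
     choice of primitive and is smooth in [x]. *)
  apply: (@int01E _ _ (fun t => phi x (K (t, y)))) => t t01.
  have [_ UM] := Vxy t t01.
  pose Ky (s : R) := K (s, y).
  have sKy : smooth_map c2 setT Ky.
    move=> i; apply: (@smooth_comp _ _ _ (coords_prod coords_real c2) setT
      [set p | U (x1, p.2)] (ccrd i \o K) (fun s : R => (s, y))) => //.
    - exact: openT.
    - exact: cylinder_open oUx.
    - by case=> j; [exact: (@smooth_ccrd _ _ coords_real setT j)|exact: (@smooth_cst _ _ setT (ccrd j y))].
  have := @is_derive_compD _ _ _ c2 (Ux x) (phi x) setT Ky t 1 (fibre_open x) (sphi x) sKy I UM.
  rewrite {2}/Ky (derive_slicel K).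
  have [_ ->] := dphi ('D_((1, 0) : R * E2) K (t, y)) UM.
  by [].
Qed.

End Local.

(** The constant over [x] is fixed by subtracting [C x], an average of values of [phi x] at
    reference points. As the weights sum to 1, the result is a weighted sum of differences of values
    of the same [phi x], to which [local_primitive] applies. *)
Lemma fibrewise_primitive : exists phi : E1 * E2 -> R,
  smooth_on U phi /\ forall z v, U z -> is_derive z ((0, v) : E1 * E2) phi (B z v).
Proof.
have /choice[phi Hphi] := fibre_primitive.
have sphi x : smooth_on (Ux x) (phi x) by have [] := Hphi x.
have dphi x y v : U (x, y) -> is_derive y v (phi x) (B (x, y) v).
  by have [_] := Hphi x; exact.
pose W : set E1 := [set x | exists y, U (x, y)].
have /choice[y0 Hy0] (x : E1) : exists y, W x -> U (x, y).
  by have [[y Uy]|nW] := pselect (W x); [exists y|exists 0].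
pose N x0 : set E1 := [set x | U (x, y0 x0)].
have oN x0 : open (N x0).
  apply: (@open_comp _ _ (fun x : E1 => (x, y0 x0)) U) => // x _.
  exact: pairl_continuous.
have Nn p : W p -> nbhs p (N p).
  by move=> Wp; apply: open_nbhs_nbhs; split=> //; exact: Hy0.
have [s [pt [ss s0 sN sfin]]] := @partition_of_unity _ _ c1 W N Nn.
have /choice[m Hm] (q : E1) : exists m, W q -> \forall x \near q,
    \sum_(n < m) s n x = 1 /\ forall n, (m <= n)%N -> s n x = 0.
  by have [/sfin[m Hm]|nW] := pselect (W q); [exists m|exists 0%N].
pose C x := \sum_(n < m x) s n x * phi x (y0 (pt n)).
pose T n (z : E1 * E2) := s n z.1 * (phi z.1 z.2 - phi z.1 (y0 (pt n))).
have fstc (P : set E1) (z : E1 * E2) : nbhs z.1 P -> \forall x \near z, P x.1.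
  by move=> HP; exact: (@cvg_fst _ _ (nbhs z.1) (nbhs z.2) _ _ HP).
have sT n : smooth_on U (T n).
  apply: smooth_germ => z Uz.
  (* Either the weight vanishes around [z.1], or [z.1] lies in [N (pt n)], so that the reference
     point belongs to its fibre. *)
  have [zero|[Wp Np]] := sN n z.1.
    exists U, (fun=> 0); split=> //; first exact: smooth_cst.
    by apply: filterS (fstc _ _ zero) => x sx; rewrite /T sx mul0r.
  pose O : set (E1 * E2) := [set z | U z /\ U (z.1, y0 (pt n))].
  have fy : continuous (fun z : E1 * E2 => (z.1, y0 (pt n))).
    move=> p; apply: (@cvg_pair _ _ _ (nbhs p) (nbhs p.1) (nbhs (y0 (pt n)))); last exact: cvg_cst.
    exact: cvg_fst.
  have oO : open O.
    by apply: openI => //; exact: (@open_comp _ _ (fun z : E1 * E2 => (z.1, y0 (pt n))) U).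
  exists O, (T n); split=> //; last by apply: filterE.
  apply: smooth_mul => //.
    apply: (@smooth_comp _ _ _ c1 O setT (s n) fst) => //; first exact: openT.
    by move=> i; exact: (@smooth_ccrd _ _ cs O (inl i)).
  apply: smooth_germ => -[x y] [Uxy Uxy0].
  have [V [psi [c [oV Vx1 sV EV]]]] := local_primitive sphi dphi (ex_intro _ y Uxy).
  pose V' : set (E1 * E2) := [set z | V z /\ V (z.1, y0 (pt n))].
  have oV' : open V'.
    by apply: openI => //; exact: (@open_comp _ _ (fun z : E1 * E2 => (z.1, y0 (pt n))) V).
  have V'xy : V' (x, y) by split; exact: Vx1.
  (* Both values of [psi] contain the uncontrolled term [phi x c], which cancels in the
     difference. *)
  exists V', (fun z => psi (z.1, y0 (pt n)) - psi z); split=> //.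
    apply: smooth_add => //; last by apply: smooth_opp => //; apply: smooth_sub sV => p [].
    apply: (@smooth_comp _ _ _ cs V' V psi (fun z => (z.1, y0 (pt n)))) => //; first by move=> p [].
    by case=> i; [exact: (@smooth_ccrd _ _ cs V' (inl i))|exact: (@smooth_cst _ _ V' (ccrd i (y0 (pt n))))].
  apply: filterS (open_nbhs_nbhs (conj oV' V'xy)) => -[a b] [/= Vab Vab0].
  by rewrite !EV //; ring.
exists (fun z => phi z.1 z.2 - C z.1); split; last first.
  move=> [x y] v Uxy; apply: is_derive_slicer => /=.
  by have := is_deriveB (dphi x y v Uxy) (is_derive_cst (C x) y v); rewrite subr0.
apply: smooth_germ => -[x y] Uxy.
exists U, (fun z => \sum_(n < m x) T n z); split=> //; first exact: smooth_sum.
have Wx : W x by exists y.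
apply: filterS2 (fstc _ (x, y) (Hm x Wx)) (open_nbhs_nbhs (conj oU Uxy)) => -[a b] /= [s1 sz] Uab.
have Wa : W a by exists b.
have -> : C a = \sum_(n < m x) s n a * phi a (y0 (pt n)).
  apply: (@sum_stable _ _ (fun n => s n a * phi a (y0 (pt n)) : R)) => n mn; last by rewrite sz // mul0r.
  by have [_ ->] := nbhs_singleton (Hm a Wa); rewrite ?mul0r.
rewrite /T /=; under eq_bigr do rewrite mulrBr.
by rewrite sumrB -mulr_suml s1 mul1r.
Qed.

End FibrewisePrimitive.

(** * The signature excludes functions defined on all nonzero vectors *)

(** [double_difference] based at [z - t *: v], with both sides [t *: v], expresses the centred
    second difference at [z], nonnegative at a minimum, as [t * t] times a second derivative nearby;
    continuity would make the latter negative. *)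
Lemma second_derivative_min {R : realType} {V : normedModType R} (U : set V) (f : V -> R)
    (z v : V) : open U -> Ck_on 2 U f -> U z ->
  (forall t : R, U (z + t *: v) -> f z <= f (z + t *: v)) ->
  0 <= 'D_v (fun x => 'D_v f x) z.
Proof.
have m11 : -1 <= 1 :> R by lra.
have lin3 (x1 x2 x3 : R) : x3 <= x1 -> x3 <= x2 -> x1 - x3 - (x3 - x2) < 0 -> False.
  by lra.
move=> oU Hf Uz fmin; rewrite leNgt; apply/negP => neg.
have n1 : \forall w \near z, 'D_v (fun x => 'D_v f x) w < 0.
  exact: (cvgr_lt _ (Ck_cont (Ck_derive v (Ck_derive v Hf)) Uz) _ neg).
have [d d0 Hd] := (nbhs_normP _ _).1 (filterI (open_nbhs_nbhs (conj oU Uz)) n1).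
pose m : R := `|v| + 1.
have m0 : 0 < m by rewrite ltr_wpDl.
pose t : R := d / m.
have t0 : 0 < t by rewrite divr_gt0.
have tv : t * `|v| < d.
  by rewrite /t mulrAC ltr_pdivrMr // ltr_pM2l // /m ltrDl.
clearbody t.
have inb (s : R) : -1 <= s <= 1 -> ball_ Num.norm z d (z + s *: (t *: v)).
  move=> /andP[s0 s1] /=; rewrite opprD addrA subrr sub0r normrN !normrZ (gtr0_norm t0).
  apply: le_lt_trans tv; rewrite ler_piMl ?mulr_ge0 ?(ltW t0) //.
  by rewrite ler_norml s0.
have inb' (a b : R) : 0 <= a <= 1 -> 0 <= b <= 1 ->
    ball_ Num.norm z d (z - t *: v + a *: (t *: v) + b *: (t *: v)).
  move=> a01 b01.
  have -> : z - t *: v + a *: (t *: v) + b *: (t *: v) = z + (a + b - 1) *: (t *: v).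
    by rewrite scalerBl scalerDl scale1r -!addrA; congr (_ + _); rewrite addrC !addrA.
  by apply: inb; lra.
have [a [b [a01 b01]]] := @double_difference _ _ U f (z - t *: v) (t *: v) (t *: v) Hf
  (fun a b a01 b01 => (Hd _ (inb' a b a01 b01)).1).
have [Uw negw] := Hd _ (inb' a b a01 b01).
rewrite (derive2_scale t v v oU Hf Uw) subrK => E.
have U1 : U (z + t *: v).
  have [] := Hd _ (inb 1 _); last by rewrite scale1r.
  by rewrite lexx andbT.
have U2 : U (z + (- t) *: v).
  have [] := Hd _ (inb (-1) _); last by rewrite scaleN1r scaleNr.
  by rewrite lexx.
have := fmin _ U1; have := fmin _ U2; rewrite scaleNr => f2 f1.
move: negw; rewrite -(pmulr_rlt0 _ t0) -(pmulr_rlt0 _ t0) -E.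
exact: lin3 f1 f2.
Qed.

Section TangentCoordinates.
Context {R : realType}.

Definition coords_tangent : coords (tangent R) := coords_prod (coords_row 4) (coords_row 4).

Lemma derive_tangent (U : set (tangent R)) (f : tangent R -> R) z v :
  open U -> Ck_on 1 U f -> U z ->
  'D_v f z = \sum_(i < 4) v.1 ord0 i * dX i f z + \sum_(i < 4) v.2 ord0 i * dY i f z.
Proof.
by move=> oU Hf Uz; rewrite (C1_deriveE coords_tangent _ oU Hf Uz) big_sumType.
Qed.

Lemma derive_vertical (U : set (tangent R)) (f : tangent R -> R) z v :
  open U -> Ck_on 1 U f -> U z ->
  'D_((0, v) : tangent R) f z = \sum_(i < 4) v ord0 i * dY i f z.
Proof.
move=> oU Hf Uz; rewrite (derive_tangent _ oU Hf Uz) [X in X + _]big1 ?add0r // => i _.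
by rewrite /= mxE mul0r.
Qed.

Lemma is_derive_fiber_coord i (z v : tangent R) :
  is_derive z v (fun p : tangent R => p.2 ord0 i) (v.2 ord0 i).
Proof. exact: (@is_derive_ccrd _ _ coords_tangent (inr i) z v). Qed.

Lemma smooth_fiber_coord i (U : set (tangent R)) :
  smooth_on U (fun p : tangent R => p.2 ord0 i).
Proof. exact: (@smooth_ccrd _ _ coords_tangent U (inr i)). Qed.

End TangentCoordinates.

Section NoGlobalLorentz.
Context {R : realType}.
Implicit Types (F : tangent R -> R) (y v : 'rV[R]_4).

Lemma smooth_Fsq U F : open U -> smooth_on U F -> smooth_on U (Fsq F).
Proof.
move=> oU sF; apply: (@smooth_ext _ _ _ (fun z => F z * F z)) => //.
exact: smooth_mul.
Qed.

(** A diagonal entry of [P *m g *m P^T] is the value of the quadratic form on a row of [P]; any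
    index other than [ord0] gives -1. *)
Lemma lorentzian_negative (g : 'M[R]_4) : lorentzian g ->
  exists v, \sum_(i < 4) \sum_(j < 4) v ord0 i * g i j * v ord0 j = -1.
Proof.
move=> [P [_ PgP]]; pose k : 'I_4 := lift ord0 ord0.
exists (row k P); have /matrixP/(_ k k) := PgP.
rewrite !mxE eqxx mulr1n /= => <-; rewrite exchange_big; apply: eq_bigr => j _.
rewrite !mxE mulr_suml; apply: eq_bigr => i _.
by rewrite !mxE.
Qed.

Lemma metric_hessian U F z v : open U -> smooth_on U F -> U z ->
  'D_((0, v) : tangent R) (fun x => 'D_((0, v) : tangent R) (Fsq F) x) z =
  2 * \sum_(i < 4) \sum_(j < 4) v ord0 i * metric F z i j * v ord0 j.
Proof.
move=> oU sF Uz; have sq := smooth_Fsq oU sF.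
have E1 x : U x -> 'D_((0, v) : tangent R) (Fsq F) x = \sum_(j < 4) v ord0 j * dY j (Fsq F) x.
  by move=> Ux; rewrite (derive_vertical _ oU (sq 1%N) Ux).
have s2 := smooth_derive ((0, v) : tangent R) sq.
rewrite (derive_vertical _ oU (s2 1%N) Uz) mulr_sumr; apply: eq_bigr => i _.
have D : is_derive z ((0, e_ i) : tangent R) (fun x => \sum_(j < 4) v ord0 j * dY j (Fsq F) x)
    (\sum_(j < 4) v ord0 j * dY i (dY j (Fsq F)) z).
  apply: is_derive_bigsum => j.
  have dj : derivable (dY j (Fsq F)) z ((0, e_ i) : tangent R).
    by have := smooth_derivable (v := (0, e_ i)) (smooth_derive ((0, e_ j) : tangent R) sq) Uz.
  by have := is_deriveZ (v ord0 j) (DeriveDef dj erefl).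
have -> : dY i (fun x => 'D_((0, v) : tangent R) (Fsq F) x) z =
    \sum_(j < 4) v ord0 j * dY i (dY j (Fsq F)) z.
  have [_ <-] := D; apply: near_eq_derive; exact: (eq_near_in oU Uz E1).
rewrite !mulr_sumr; apply: eq_bigr => j _; rewrite mxE.
by move: (dY i _ z) => d; field.
Qed.

(** A smooth comparison function: the norm of rows is the maximum of the absolute values of the
    coordinates, which is not differentiable everywhere. *)
Definition euclid y : R := \sum_(i < 4) y ord0 i * y ord0 i.

Lemma euclid_continuous : continuous euclid.
Proof.
move=> y; have FF : Filter (nbhs y) by exact: nbhs_filter.
apply: (@cvg_bigsum R R _ (nbhs y) FF _ _ (fun i (x : 'rV[R]_4) => x ord0 i * x ord0 i)) => i.
by apply: cvgM; exact: coord_continuous.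
Qed.

Lemma euclid_gt0 y : y != 0 -> 0 < euclid y.
Proof.
move=> y0; have [i yi] : exists i, y ord0 i != 0.
  apply: contrapT => /forallNP H; case/eqP: y0; apply/rowP => i.
  by rewrite mxE; apply/eqP/negPn/negP; exact: H.
rewrite /euclid (bigD1 i) //= ltr_pwDl //; first by rewrite -expr2 exprn_even_gt0.
by apply: sumr_ge0 => j _; rewrite -expr2 sqr_ge0.
Qed.

Lemma euclidZ (a : R) y : euclid (a *: y) = a ^+ 2 * euclid y.
Proof. by rewrite /euclid mulr_sumr; apply: eq_bigr => i _; rewrite !mxE; ring. Qed.

Lemma euclid1_neq0 y : euclid y = 1 -> y != 0.
Proof.
move=> y1; apply/eqP => y0; move: y1; rewrite y0 /euclid big1.
  by move/eqP; rewrite eq_sym oner_eq0.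
by move=> i _; rewrite mxE mul0r.
Qed.

Lemma sphere_compact : compact [set y | euclid y = 1].
Proof.
apply: bounded_closed_compact.
  pose M : R := \sum_(i < 4) `|cvec (c := coords_row 4) i|.
  exists M; split; first exact: num_real.
  move=> r Mr y /= y1; apply/ltW/(le_lt_trans _ Mr).
  rewrite [y](ccrdE (coords_row 4)); apply: le_trans (ler_norm_sum _ _ _) _.
  apply: ler_sum => i _; rewrite normrZ ler_piMl //=.
  have : `|y ord0 i| ^+ 2 <= 1.
    rewrite real_normK ?num_real // -y1 /euclid (bigD1 i) //= expr2 lerDl.
    by apply: sumr_ge0 => j _; rewrite -expr2 sqr_ge0.
  by rewrite expr_le1.
have -> : [set y | euclid y = 1] = euclid @^-1` [set 1] by [].
apply: closed_comp => [y _|]; first exact: euclid_continuous.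
exact: closed_eq.
Qed.

(* On the Euclidean unit sphere of a fibre [F ^+ 2] attains its minimum [m >= 0]; by
   homogeneity [F ^+ 2 - m * euclid] has a minimum there, so that the Hessian of [F ^+ 2]
   is positive semidefinite at that point. *)
Lemma slit_not_lorentzian F : ~ pseudo_finsler slit F.
Proof.
move=> [[oD _] _ sF hom lor].
have sl y : y != 0 -> slit ((0, y) : tangent R) by [].
have nz := euclid1_neq0.
pose f y := Fsq F (0, y).
have [c cS cmin] : exists2 c, c \in [set y | euclid y = 1] & forall y,
    y \in [set y | euclid y = 1] -> f c <= f y.
  apply: (@compact_EVT_min _ R f).
  - exists (delta_mx ord0 ord0); rewrite /= /euclid (bigD1 ord0) //= !mxE !eqxx mulr1 big1 ?addr0 //.
    by move=> i i0; rewrite !mxE /= (negbTE i0) mulr0.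
  - exact: sphere_compact.
  apply: continuous_in_subspaceT => y /set_mem /nz y0.
  apply: (@continuous_comp _ _ _ (fun y => ((0, y) : tangent R)) (Fsq F)).
    exact: pair_continuous.
  exact: (smooth_cont (smooth_Fsq oD sF) (sl y y0)).
have c1 : euclid c = 1 by move: cS; rewrite inE.
have c0 := nz c c1; set m := f c in cmin.
have m0 : 0 <= m by rewrite /m /f /Fsq sqr_ge0.
(* The bound passes from the sphere to all nonzero vectors because [F ^+ 2] and [euclid] are both
   homogeneous of degree 2. *)
have fge y : y != 0 -> m * euclid y <= f y.
  move=> y0; have e0 := euclid_gt0 y0.
  pose r := Num.sqrt (euclid y); have r0 : 0 < r by rewrite sqrtr_gt0.
  have r2 : r ^+ 2 = euclid y by rewrite sqr_sqrtr // ltW.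
  have S1 : euclid (r^-1 *: y) = 1.
    by rewrite euclidZ exprVn r2 mulVf // gt_eqF.
  have := cmin (r^-1 *: y); rewrite inE /= => /(_ S1).
  have -> : f y = r ^+ 2 * f (r^-1 *: y).
    have := hom 0 (r^-1 *: y) r r0 (sl _ (nz _ S1)).
    rewrite scalerA divff ?gt_eqF // scale1r => Fy.
    by rewrite /f /Fsq Fy exprMn.
  by rewrite r2 mulrC; rewrite ler_pM2l.
have [v Hv] := lorentzian_negative (lor _ (sl c c0)).2.
(* On nonzero vectors over 0 [Psi] is nonnegative, and it vanishes at [c]. Its second derivative
   along [(0, v)] is [- 2 - m * (2 * euclid v)], since the metric takes the value -1 on [v]: a
   contradiction. *)
pose Psi (z : tangent R) := Fsq F z - m * \sum_(i < 4) z.2 ord0 i * z.2 ord0 i.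
pose V : tangent R := (0, v).
have sq : smooth_on slit (fun z : tangent R => \sum_(i < 4) z.2 ord0 i * z.2 ord0 i).
  by apply: smooth_sum => // i _; apply: smooth_mul => //; exact: smooth_fiber_coord.
have sPsi : smooth_on slit Psi.
  apply: smooth_add => //; first exact: smooth_Fsq.
  by apply: smooth_opp => //; apply: smooth_mul => //; exact: smooth_cst.
have line (t : R) : ((0, c) : tangent R) + t *: V = (0, c + t *: v).
  by congr pair; rewrite /= scaler0 addr0.
have := @second_derivative_min _ _ slit Psi ((0, c) : tangent R) V oD (sPsi 2%N) (sl c c0).
have -> : 'D_V (fun x => 'D_V Psi x) (0, c) = - 2 - m * (2 * euclid v).
  have D1 z : slit z -> is_derive z V Psi ('D_V (Fsq F) z - m * \sum_(i < 4) 2 * (v ord0 i * z.2 ord0 i)).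
    move=> Dz; apply: is_deriveB.
      by apply: DeriveDef => //; exact: smooth_derivable (smooth_Fsq oD sF) Dz.
    apply: is_deriveZ; apply: is_derive_bigsum => i.
    have := is_deriveM (is_derive_fiber_coord i z V) (is_derive_fiber_coord i z V).
    by rewrite /GRing.scale /= (_ : _ + _ = 2 * (v ord0 i * z.2 ord0 i)) //; ring.
  have D2 : is_derive ((0, c) : tangent R) V
     (fun z : tangent R => 'D_V (Fsq F) z - m * \sum_(i < 4) 2 * (v ord0 i * z.2 ord0 i))
     ('D_V (fun x => 'D_V (Fsq F) x) (0, c) - m * \sum_(i < 4) 2 * (v ord0 i * v ord0 i)).
    apply: is_deriveB.
      apply: DeriveDef => //.
      exact: smooth_derivable (smooth_derive V (smooth_Fsq oD sF)) (sl c c0).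
    apply: is_deriveZ; apply: is_derive_bigsum => i.
    apply: (is_deriveZ 2); apply: is_deriveZ.
    exact: is_derive_fiber_coord.
  transitivity ('D_V (fun x => 'D_V (Fsq F) x) (0, c) - m * \sum_(i < 4) 2 * (v ord0 i * v ord0 i)).
    have [_ <-] := D2; apply: near_eq_derive; apply: (eq_near_in oD (sl c c0)) => z Dz.
    by have [_ ->] := D1 z Dz.
  by rewrite (metric_hessian v oD sF (sl c c0)) Hv mulrN1 -mulr_sumr.
have v0 : 0 <= euclid v by apply: sumr_ge0 => i _; rewrite -expr2 sqr_ge0.
have mv : 0 <= m * (2 * euclid v) by apply: mulr_ge0 => //; apply: mulr_ge0.
suff H : forall t : R, slit ((0, c) + t *: V) -> Psi (0, c) <= Psi ((0, c) + t *: V).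
  by move=> /(_ H); lra.
move=> t; rewrite line => ct0; rewrite /Psi /= -/(euclid c) c1 mulr1 -/(f c) -/m subrr subr_ge0.
exact: fge.
Qed.

End NoGlobalLorentz.

(** * The Poincare lemma for 2-forms *)

Section ExactTwoForm.
Context {R : realType} {E : normedModType R} (cs : coords E).

Lemma closed_2form_exact (U : set E) (w : E -> E -> E -> R) :
  open U -> contractible R U ->
  (forall z v, linear (fun u => w z u v)) -> (forall z u, linear (w z u)) ->
  (forall u v, smooth_on U (fun z => w z u v)) ->
  (forall z u v, w z u v = - w z v u) ->
  (forall z x u v, U z -> 'D_x (fun z => w z u v) z -
    'D_u (fun z => w z x v) z + 'D_v (fun z => w z x u) z = 0) ->
  exists B : E -> E -> R,
    [/\ forall z, linear (B z), forall v, smooth_on U (B^~ v) &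
        forall z u v, U z -> 'D_u (B^~ v) z - 'D_v (B^~ u) z = w z u v].
Proof.
move=> oU ctr Lw1 Lw2 sw aw dw.
have [c [K [Uc sK KU K01]]] := smooth_contraction cs oU ctr.
pose B0 := primitive2 K w.
(* Extended by 0 so that [B z] is linear also for [z] outside [U]. *)
pose B (z v : E) : R := if `[< U z >] then B0 z v else 0.
have BE v z : U z -> B0 z v = B z v by move=> Uz; rewrite /B asboolT.
have sB0 v : smooth_on U (B0^~ v) by exact: (smooth_primitive2 oU sK KU Lw1 Lw2 sw v).
exists B; split.
- move=> z; rewrite /B; case: asboolP => [Uz|_]; last by move=> a u v; rewrite scaler0 addr0.
  exact: (linear_primitive2 oU sK KU Lw1 Lw2 sw Uz).
- by move=> v; apply: smooth_ext (sB0 v) => // z; exact: BE.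
- move=> z u v Uz.
  have D x y : 'D_x (B^~ y) z = 'D_x (B0^~ y) z.
    by have [_ ->] := derive_eq_in oU Uz (BE y) (smooth_derivable (v := x) (sB0 y) Uz).
  rewrite !D; exact: (ext_primitive2 oU sK KU K01 Lw1 Lw2 sw aw dw u v Uz).
Qed.

End ExactTwoForm.

Section LinearFunctions.
Context {R : realType} {E : normedModType R}.
Implicit Types f g : E -> R.

Lemma linear_bigsum (I : Type) (r : seq I) (f : I -> E -> R) :
  (forall i, linear (f i)) -> linear (fun v => \sum_(i <- r) f i v).
Proof.
move=> H a u v; rewrite scaler_sumr -big_split /=; apply: eq_bigr => i _; exact: H.
Qed.

Lemma linear_add f g : linear f -> linear g -> linear (fun v => f v + g v).
Proof. by move=> Hf Hg a u v; rewrite Hf Hg scalerDr addrACA. Qed.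

Lemma linear_scale (c : R) f : linear f -> linear (fun v => c * f v).
Proof. by move=> Hf a u v; rewrite Hf mulrDr scalerAr. Qed.

Lemma linear_opp f : linear f -> linear (fun v => - f v).
Proof. by move=> Hf a u v; rewrite Hf opprD scalerN. Qed.

End LinearFunctions.

(** * The electromagnetic form as a skew bilinear function *)

Section ElectromagneticForm.
Context {R : realType}.
Variables (F : tangent R -> R) (Fh Fm : 'I_4 -> 'I_4 -> tangent R -> R).

Definition vec2 (u v : tangent R) (i : 'I_2) : tangent R := if val i is 0%N then u else v.

Definition vec3 (x u v : tangent R) (i : 'I_3) : tangent R :=
  match val i with 0%N => x | 1%N => u | _ => v end.

Definition em (z u v : tangent R) : R := em_form F Fh Fm z (vec2 u v).

Lemma em_formE z (v : 'I_2 -> tangent R) : em_form F Fh Fm z v = em z (v ord0) (v ord_max).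
Proof. by []. Qed.

Let theta (z : tangent R) (a : 'I_4) (v : tangent R) : R := deltay F a z (fun=> v).

Lemma emE z u v : em z u v =
  2^-1 * \sum_(i < 4) \sum_(j < 4) Fh i j z *
    (u.1 ord0 i * v.1 ord0 j - v.1 ord0 i * u.1 ord0 j) +
  \sum_(i < 4) \sum_(a < 4) Fm i a z *
    (u.1 ord0 i * theta z a v - v.1 ord0 i * theta z a u).
Proof. by []. Qed.

Lemma em_skew z u v : em z u v = - em z v u.
Proof.
rewrite !emE opprD -mulrN -!sumrN; congr (_ * _ + _); apply: eq_bigr => i _;
  by rewrite -sumrN; apply: eq_bigr => j _; rewrite -[RHS]mulrN opprB.
Qed.

Lemma linear_base (i : 'I_4) : linear (fun v : tangent R => v.1 ord0 i : R).
Proof. by move=> a u v; rewrite !mxE. Qed.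

Lemma linear_fiber (i : 'I_4) : linear (fun v : tangent R => v.2 ord0 i : R).
Proof. by move=> a u v; rewrite !mxE. Qed.

Lemma linear_theta z a : linear (theta z a).
Proof.
apply: linear_add; first exact: linear_fiber.
by apply: linear_bigsum => i; apply: linear_scale; exact: linear_base.
Qed.

Lemma em_linear_r z u : linear (em z u).
Proof.
have L1 (i : 'I_4) (f : tangent R -> R) (c : R) : linear f ->
    linear (fun v : tangent R => u.1 ord0 i * f v - v.1 ord0 i * c).
  move=> Lf; apply: linear_add; first exact: linear_scale.
  apply: linear_opp => a x y; rewrite (linear_base i a x y) mulrDl.
  by rewrite -scalerAl.
apply: linear_add.
  apply: linear_scale; apply: linear_bigsum => i; apply: linear_bigsum => j.
  by apply: linear_scale; apply: L1; exact: linear_base.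
apply: linear_bigsum => i; apply: linear_bigsum => a.
by apply: linear_scale; exact: (L1 i (theta z a) (theta z a u) (@linear_theta z a)).
Qed.

Lemma em_linear_l z v : linear (fun u => em z u v).
Proof.
move=> a x y; rewrite 3!(em_skew z _ v) (em_linear_r z v a x y) opprD.
by rewrite scalerN.
Qed.

(** Every term of the form contains a factor [dx]. This is what makes the vertical part of a
    potential closed on the fibres. *)
Lemma em_vertical z u v : em z (0, u) (0, v) = 0.
Proof.
rewrite emE big1 ?mulr0 ?add0r; last first.
  by move=> i _; rewrite big1 // => j _; rewrite !mxE !mul0r subrr mulr0.
by apply: big1 => i _; rewrite big1 // => j _; rewrite !mxE !mul0r subrr mulr0.
Qed.

(** On vertical vectors [deltay] is [dy]; on [(e_ i, 0)] it takes the value of a connection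
    coefficient, but multiplied by [dx] of a vertical vector. So [Fm] is read off without the
    connection. *)
Lemma em_mixed z i a : em z (e_ i, 0) (0, e_ a) = Fm i a z.
Proof.
rewrite emE big1 ?mulr0 ?add0r; last first.
  by move=> k _; rewrite big1 // => j _; rewrite !mxE mulr0 mul0r subrr mulr0.
have th0 b (v : 'rV[R]_4) : theta z b (0, v) = v ord0 b.
  rewrite /theta /deltay /dy_ /dx_ /= big1 ?addr0 // => k _.
  by rewrite mxE mulr0.
rewrite (bigD1 i) //= (bigD1 a) //= !th0 !mxE !eqxx /= !mul1r mul0r subr0 mulr1.
rewrite big1 ?addr0; last first.
  by move=> b ba; rewrite th0 !mxE /= (negbTE ba) mul0r subr0 mulr0 mulr0.
rewrite big1 ?addr0 // => k ki; apply: big1 => b _.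
by rewrite !mxE /= (negbTE ki) !mul0r subrr mulr0.
Qed.

Lemma em_closed z x u v : ext_d (em_form F Fh Fm) z (vec3 x u v) =
  'D_x (fun z => em z u v) z - 'D_u (fun z => em z x v) z + 'D_v (fun z => em z x u) z.
Proof.
rewrite /ext_d !big_ord_recl big_ord0 addr0 /= expr0 mul1r.
by rewrite /bump /= expr1 mulN1r addrA expr2 mulrNN !mul1r.
Qed.

End ElectromagneticForm.

(** * Horizontal potentials *)

Section HorizontalPotential.
Context {R : realType}.

Lemma slice_contractible (D U : set (tangent R)) : D <> slit ->
  (D <> slit -> forall x : base R, fiber U x !=set0 -> contractible R (fiber U x)) ->
  forall x : base R, [set y | U (x, y)] !=set0 -> contractible R [set y | U (x, y)].
Proof. by move=> nD H x; exact: H. Qed.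

Lemma horizontalE (A : 'I_4 -> tangent R -> R) z (v : 'I_2 -> tangent R) :
  ext_d (horizontal_form A) z v =
  'D_(v ord0) (fun p => \sum_(i < 4) A i p * (v ord_max).1 ord0 i) z -
  'D_(v ord_max) (fun p => \sum_(i < 4) A i p * (v ord0).1 ord0 i) z.
Proof.
rewrite /ext_d !big_ord_recl big_ord0 addr0 /= expr0 mul1r /bump /= expr1 mulN1r.
have E1 : lift ord0 ord0 = ord_max :> 'I_2 by apply: val_inj.
have E2 : lift ord_max ord0 = ord0 :> 'I_2 by apply: val_inj.
by rewrite /horizontal_form /dx_ !E1 !E2.
Qed.

Lemma horizontal_potential (U : set (tangent R)) (w : tangent R -> tangent R -> tangent R -> R) :
  open U -> contractible R U ->
  (forall x : base R, [set y | U (x, y)] !=set0 -> contractible R [set y | U (x, y)]) ->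
  (forall z v, linear (fun u => w z u v)) -> (forall z u, linear (w z u)) ->
  (forall u v, smooth_on U (fun z => w z u v)) ->
  (forall z u v, w z u v = - w z v u) ->
  (forall z x u v, U z -> 'D_x (fun z => w z u v) z -
    'D_u (fun z => w z x v) z + 'D_v (fun z => w z x u) z = 0) ->
  (forall z u v, w z (0, u) (0, v) = 0) ->
  exists A : 'I_4 -> tangent R -> R, (forall i, smooth_on U (A i)) /\
    forall z (u v : tangent R), U z -> 'D_u (fun p => \sum_(i < 4) A i p * v.1 ord0 i) z -
      'D_v (fun p => \sum_(i < 4) A i p * u.1 ord0 i) z = w z u v.
Proof.
move=> oU ctr cfib Lw1 Lw2 sw aw dw wv.
have [B [LB sB dB]] := closed_2form_exact coords_tangent oU ctr Lw1 Lw2 sw aw dw.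
pose Bv (z : tangent R) (v : 'rV[R]_4) := B z (0, v).
have LBv z : linear (Bv z).
  move=> a u v; rewrite /Bv -LB; congr (B z _).
  by congr pair; rewrite /= scaler0 addr0.
have sBv v : smooth_on U (Bv^~ v) by exact: (sB (0, v)).
have cBv z u v : U z ->
    'D_((0, u) : tangent R) (Bv^~ v) z = 'D_((0, v) : tangent R) (Bv^~ u) z.
  by move=> Uz; apply/eqP; rewrite -subr_eq0; apply/eqP; rewrite (dB z (0, u) (0, v) Uz) wv.
have [phi [sphi dphi]] := fibrewise_primitive (coords_row 4) (coords_row 4) oU cfib LBv sBv cBv.
pose A i z := B z (e_ i, 0) - dX i phi z.
(* The vertical parts of [B] and of the differential of [phi] coincide, so dropping the vertical
   components of [u] on the left loses nothing. *)
have aE z (u : tangent R) : U z -> \sum_(i < 4) A i z * u.1 ord0 i = B z u - 'D_u phi z.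
  move=> Uz.
  rewrite (derive_tangent u oU (sphi 1%N) Uz) (lin_expand coords_tangent u (LB z)) big_sumType /=.
  have -> : \sum_(i < 4) u.2 ord0 i * dY i phi z = \sum_(i < 4) u.2 ord0 i * B z (0, e_ i).
    by apply: eq_bigr => i _; congr (_ * _); have [_ E] := dphi z (e_ i) Uz; exact: E.
  rewrite opprD addrACA subrr addr0 -sumrB; apply: eq_bigr => i _.
  by rewrite /A mulrBl [X in X - _]mulrC [X in _ - X]mulrC.
exists A; split=> [i|z u v Uz].
  apply: smooth_add => //; apply: smooth_opp => //.
  exact: (smooth_derive ((e_ i, 0) : tangent R) sphi).
have D (x y : tangent R) : 'D_x (fun p => \sum_(i < 4) A i p * y.1 ord0 i) z =
    'D_x (B^~ y) z - 'D_x (fun p => 'D_y phi p) z.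
  have dBy : is_derive z x (B^~ y) ('D_x (B^~ y) z).
    by apply: DeriveDef => //; exact: smooth_derivable (sB y) Uz.
  have dp : is_derive z x (fun p => 'D_y phi p) ('D_x (fun p => 'D_y phi p) z).
    by apply: DeriveDef => //; exact: smooth_derivable (smooth_derive y sphi) Uz.
  have [_ <-] := is_deriveB dBy dp.
  by apply: near_eq_derive; apply: (eq_near_in oU Uz) => p Up; rewrite aE.
rewrite !D (schwarz u v oU (sphi 2%N) Uz) -(dB z u v Uz).
by rewrite opprB addrA subrK.
Qed.

(** For [L] the contraction of [A] with [y], [dY a L] is [A a] minus the contraction of [Fm] with
    [y] in its first index, which vanishes; Euler's identity is then the definition of [L].
    Contraction in the second index makes each [A i] constant along the segment from [y] to
    [l *: y], whence the scaling law. *)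
Lemma homogeneous_primitive (U : set (tangent R)) (A : 'I_4 -> tangent R -> R)
    (Fm : 'I_4 -> 'I_4 -> tangent R -> R) :
  open U -> U `<=` slit -> (forall i, smooth_on U (A i)) ->
  (forall z i a, U z -> dY a (A i) z = - Fm i a z) ->
  (forall z a, U z -> \sum_(i < 4) Fm i a z * z.2 ord0 i = 0) ->
  (forall z i, U z -> \sum_(a < 4) Fm i a z * z.2 ord0 a = 0) ->
  exists L1 : tangent R -> R,
    [/\ smooth_on U L1, homogeneous1_on U L1 & forall z i, U z -> A i z = dY i L1 z].
Proof.
move=> oU Us sA dA H1 H2.
pose L (z : tangent R) := \sum_(i < 4) A i z * z.2 ord0 i.
have dL z a : U z -> A a z = dY a L z.
  move=> Uz.
  have D : is_derive z ((0, e_ a) : tangent R) L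
      (\sum_(i < 4) (A i z * (e_ a : base R) ord0 i + z.2 ord0 i * (- Fm i a z))).
    apply: is_derive_bigsum => i; apply: is_deriveM; last exact: is_derive_fiber_coord.
    rewrite -(dA z i a Uz); apply: DeriveDef => //.
    exact: smooth_derivable (sA i) Uz.
  have [_ E] := D; rewrite /dY E big_split /=.
  rewrite [X in _ + X](_ : _ = 0) ?addr0; last first.
    apply/eqP; rewrite -oppr_eq0 -sumrN; apply/eqP.
    by rewrite -[RHS](H1 z a Uz); apply: eq_bigr => i _; rewrite mulrN opprK mulrC.
  rewrite (bigD1 a) //= big1 ?addr0.
    by rewrite /e_ mxE !eqxx mulr1.
  by move=> i ia; rewrite /e_ mxE (negbTE ia) andbF mulr0.
exists L; split=> //.
  by apply: smooth_sum => // i _; apply: smooth_mul => //; exact: smooth_fiber_coord.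
split=> [z Uz|x y l Hl].
  by apply: eq_bigr => i _; rewrite -dL.
have cst i : A i (x, l *: y) = A i (x, y).
  apply/eqP; rewrite -subr_eq0; apply/eqP.
  pose V : tangent R := (0, (l - 1) *: y).
  have line (t : R) : ((x, y) : tangent R) + t *: V = (x, (1 - t + t * l) *: y).
    congr pair; rewrite /= ?scaler0 ?addr0 // scalerA -[X in X + _]scale1r -scalerDl.
    by congr (_ *: _); ring.
  have Ut (t : R) : 0 <= t <= 1 -> U ((x, y) + t *: V).
    by move=> t01; rewrite line; apply: Hl; rewrite in_itv.
  have [t t01] : exists2 t : R, 0 <= t <= 1 &
      A i ((x, y) + V) - A i (x, y) = 'D_V (A i) ((x, y) + t *: V).
    by apply: mvt_line => t t01; exact: smooth_derivable (sA i) (Ut t t01).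
  have := line 1; rewrite scale1r subrr add0r mul1r => ->.
  have Uw := Ut t t01.
  rewrite (derive_vertical _ oU (sA i 1%N) Uw) => ->.
  have := H2 _ i Uw; have := Us _ Uw; have dw a := dA _ i a Uw.
  move: dw; rewrite line; set s := 1 - t + t * l => dw sy0 H.
  (* The contraction is known at [s *: y] and has to be divided by [s]; as [U] avoids the zero
     section, the segment never meets 0. *)
  have s0 : s != 0 by apply: contra_neq sy0 => /= ->; rewrite scale0r.
  have Hs : \sum_(a < 4) Fm i a (x, s *: y) * y ord0 a = 0.
    apply: (mulfI s0); rewrite mulr0 -[RHS]H mulr_sumr; apply: eq_bigr => a _.
    by rewrite /= mxE mulrCA.
  rewrite (eq_bigr (fun a => - (l - 1) * (Fm i a (x, s *: y) * y ord0 a))); last first.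
    by move=> a _; rewrite dw mxE; ring.
  by rewrite -mulr_sumr Hs mulr0.
rewrite /L mulr_sumr; apply: eq_bigr => i _.
by rewrite cst /= mxE mulrCA.
Qed.

End HorizontalPotential.

Theorem theorem9 (R : realType) (D : set (tangent R)) (F : tangent R -> R)
    (hF : pseudo_finsler D F)
    (U : set (tangent R)) (Uopen : open U) (UD : U `<=` D)
    (Ucontr : contractible R U)
    (Ufib : D <> slit -> forall x : base R,
       fiber U x !=set0 -> contractible R (fiber U x))
    (Fh Fm : 'I_4 -> 'I_4 -> tangent R -> R)
    (Fsmooth : smooth_form U (em_form F Fh Fm))
    (Fclosed : forall z v, U z -> ext_d (em_form F Fh Fm) z v = 0) :
  exists A : 'I_4 -> tangent R -> R,
    [/\ forall i, smooth_on U (A i),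
        forall z v, U z -> em_form F Fh Fm z v = ext_d (horizontal_form A) z v &
        (forall z a, U z -> \sum_(i < 4) Fm i a z * z.2 ord0 i = 0) ->
        (forall z i, U z -> \sum_(a < 4) Fm i a z * z.2 ord0 a = 0) ->
        exists L1 : tangent R -> R,
          [/\ smooth_on U L1,
              homogeneous1_on U L1 &
              forall z i, U z -> A i z = dY i L1 z]].
Proof.
have Dslit : D <> slit by move=> DS; move: hF; rewrite DS; exact: slit_not_lorentzian.
have [[_ Ds] _ _ _ _] := hF.
have [A [sA dA]] := horizontal_potential Uopen Ucontr (slice_contractible Dslit Ufib)
  (em_linear_l F Fh Fm) (em_linear_r F Fh Fm) (fun u v => Fsmooth (vec2 u v))
  (em_skew F Fh Fm)
  (fun z x u v Uz => etrans (esym (em_closed F Fh Fm z x u v)) (Fclosed z (vec3 x u v) Uz))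
  (em_vertical F Fh Fm).
exists A; split=> // [z v Uz|H1 H2].
  by rewrite em_formE horizontalE; apply/esym; exact: dA.
apply: (@homogeneous_primitive R U A Fm) => //; first exact: subset_trans UD Ds.
(* A horizontal form vanishes on [(0, e_ a)], so its exterior derivative on this pair of vectors is
   just [- dY a (A i)]. *)
move=> z i a Uz; rewrite -(em_mixed F Fh Fm z i a) -(dA z (e_ i, 0) (0, e_ a) Uz).
have -> : (fun p => \sum_(k < 4) A k p * ((0, e_ a) : tangent R).1 ord0 k) = cst 0.
  by apply/funext => p; apply: big1 => k _; rewrite /= mxE mulr0.
have -> : (fun p => \sum_(k < 4) A k p * ((e_ i, 0) : tangent R).1 ord0 k) = A i.
  apply/funext => p; rewrite (bigD1 i) //= big1 ?addr0.
    by rewrite mxE !eqxx mulr1.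
  by move=> k ki; rewrite mxE (negbTE ki) andbF mulr0.
by rewrite derive_cst sub0r opprK.
Qed.
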